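(* Let $G$ be a second countable locally compact abelian group, $\Gamma$ a closed subgroup of $G$, and let $\Omega$, $C$, $Z$ be as fixed in the context. Suppose that $V\subseteq L^2(G)$ is a $\Gamma$-translation invariant space with associated range function $J$. Let $U:V\to V$ be a compact $\Gamma$-translation preserving operator with range operator $R$. (1) If $U$ is a Hilbert–Schmidt operator, then so is $R(\omega)$ for a.e. $\omega\in\Omega$. (2) If $U$ is positive and of finite trace, then so is $R(\omega)$ for a.e. $\omega\in\Omega$.
   Context: Setting. $G$ is a second countable locally compact abelian group, $\Gamma\le G$ a closed subgroup (not necessarily discrete or cocompact), $\widehat G$ the dual group, $\Gamma^*=\{\chi\in\widehat G:\chi(\gamma)=1\ \forall\gamma\in\Gamma\}$ the annihilator of $\Gamma$. $\Omega$ is a Borel measurable section (set of coset representatives) of $\widehat G/\Gamma^*$ and $C$ is a Borel measurable section of $G/\Gamma$; they carry the measures obtained by identifying them with the quotient groups $\widehat G/\Gamma^*$ and $G/\Gamma$ equipped with suitably normalized Haar measures. For $\gamma\in\Gamma$, $X_\gamma$ is the character $X_\gamma(\chi)=\chi(\gamma)$ of $\widehat G$, and $T_\gamma$ is translation on $L^2(G)$, $(T_\gamma f)(x)=f(x-\gamma)$. $L^2(\Omega,L^2(C))$ is the Hilbert space of square integrable measurable $L^2(C)$-valued functions on $\Omega$. A known result provides an isometric isomorphism (surjective linear isometry) $Z:L^2(G)\to L^2(\Omega,L^2(C))$ satisfying $Z(T_\gamma\phi)=X_\gamma|_\Omega\, Z(\phi)$ for all $\gamma\in\Gamma$, $\phi\in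 L^2(G)$; this $Z$ is fixed. A $\Gamma$-translation invariant space is a closed subspace $V\subseteq L^2(G)$ with $T_\gamma V\subseteq V$ for all $\gamma\in\Gamma$. A range function is a map $J:\Omega\to\{\text{closed subspaces of }L^2(C)\}$; $P_J(\omega)$ is the orthogonal projection onto $J(\omega)$; $J$ is measurable if $\omega\mapsto\langle P_J(\omega)a,b\rangle$ is measurable for all $a,b\in L^2(C)$. It is known that each $\Gamma$-translation invariant space $V$ has a measurable range function $J$, unique up to a.e. equality, with $V=\{f\in L^2(G): Z(f)(\omega)\in J(\omega)\text{ for a.e. }\omega\in\Omega\}$; this is the range function associated to $V$. A bounded linear operator $U:V\to L^2(G)$ is $\Gamma$-translation preserving if $UT_\gamma=T_\gamma U$ on $V$ for all $\gamma\in\Gamma$. A range operator on $J$ is a map $R$ assigning to (almost) every $\omega\in\Omega$ a bounded linear operator $R(\omega):J(\omega)\to L^2(C)$; it is measurable if $\omega\mapsto\langle R(\omega)P_J(\omega)a,b\rangle$ is measurable for all $a,b\in L^2(C)$. The range operator of a $\Gamma$-translation preserving $U$ is the (a.e. unique) measurable range operator $R$ on $J$ with $(ZU\phi)(\omega)=R(\omega)((Z\phi)(\omega))$ for a.e. $\omega\in\Omega$, for all $\phi\in V$. When $U$ maps $V$ into $V$, $R(\omega)$ is an operator on $J(\omega)$ for a.e. $\omega$. For an operator $T$ on a Hilbert space with orthonormal basis $E$, $\|T\|_{HS}=\big(\sum_{x\in E}\|Tx\|^2\big)^{1/2}$ ($T$ is Hilbert–Schmidt if this is finite), and $T$ is of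 finite trace if $\operatorname{tr}(T)=\sum_{x\in E}\langle Tx,x\rangle<\infty$. *)

(* Defs.v *)
From HB Require Import structures.
From mathcomp Require Import all_boot all_order all_algebra.
From mathcomp Require Import complex ring lra.
From mathcomp Require Import all_classical all_reals all_analysis.
From mathcomp Require Import measurable_realfun.

Set Implicit Arguments.
Unset Strict Implicit.
Unset Printing Implicit Defensive.

Import Order.TTheory GRing.Theory Num.Theory numFieldNormedType.Exports.
Import Quotient.

Local Open Scope classical_set_scope.
Local Open Scope ring_scope.

(* Inner product spaces over the complex field R[i], linear in the first
   argument. Completeness is not part of the structure. *)
HB.mixin Record NormedModule_isInnerProduct (R : realType) H
    & NormedModule R[i] H := {
  dotp : H -> H -> R[i];
  dotp_linearl : forall z, scalar (dotp ^~ z);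
  dotpC : forall x y, dotp x y = ((dotp y x)^*)%C;
  dotpp : forall x, dotp x x = `|x| ^+ 2
}.

#[short(type="innerProductType")]
HB.structure Definition InnerProduct (R : realType) :=
  {H of NormedModule R[i] H & NormedModule_isInnerProduct R H}.

HB.factory Record Lmodule_isInnerProduct (R : realType) H
    & GRing.Lmodule R[i] H := {
  dotp : H -> H -> R[i];
  dotp_linearl : forall z, scalar (dotp ^~ z);
  dotpC : forall x y, dotp x y = ((dotp y x)^*)%C;
  dotp_ge0 : forall x, 0 <= dotp x x;
  dotp_eq0 : forall x, dotp x x = 0 -> x = 0
}.

HB.builders Context R H & Lmodule_isInnerProduct R H.

Let nrm (x : H) : R[i] := sqrtC (dotp x x).

Let Dl x y z : dotp (x + y) z = dotp x z + dotp y z.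
Proof. by have := dotp_linearl z 1 x y; rewrite scale1r mul1r. Qed.

Let l0 z : dotp 0 z = 0.
Proof. by apply: (addrI (dotp 0 z)); rewrite -Dl !addr0. Qed.

Let Zl a x z : dotp (a *: x) z = a * dotp x z.
Proof. by have := dotp_linearl z a x 0; rewrite l0 !addr0. Qed.

Let Dr x y z : dotp z (x + y) = dotp z x + dotp z y.
Proof. by rewrite dotpC Dl rmorphD /= -!dotpC. Qed.

Let Zr a x z : dotp z (a *: x) = (a^*)%C * dotp z x.
Proof. by rewrite dotpC Zl rmorphM /= -dotpC. Qed.

Let nrm_ge0 x : 0 <= nrm x. Proof. by rewrite sqrtC_ge0 dotp_ge0. Qed.

Let CS x y : `|dotp x y| <= nrm x * nrm y.
Proof.
have [y0|y0] := eqVneq y 0.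
  by rewrite y0 dotpC l0 rmorph0 normr0 mulr_ge0.
have dy : 0 < dotp y y.
  by rewrite lt_def dotp_ge0 andbT; apply: contra_neq y0; exact: dotp_eq0.
rewrite -ler_sqr ?nnegrE ?mulr_ge0// exprMn !sqrtCK.
set a := dotp x y / dotp y y.
have /= := dotp_ge0 (x - a *: y).
rewrite -scaleNr Dl !Dr !Zl !Zr.
rewrite [dotp y x]dotpC.
have yr : ((dotp y y)^*)%C = dotp y y by rewrite -dotpC.
rewrite rmorphN /a rmorphM fmorphV /= yr.
have n2 : `|dotp x y| ^+ 2 = dotp x y * ((dotp x y)^*)%C.
  by rewrite normCK; case: (dotp x y).
rewrite n2.
set p := dotp x y; set q := (p^*)%C; set d := dotp y y.
have d0 : d != 0 by rewrite gt_eqF.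
have -> : dotp x x + - (q / d) * p + (- (p / d) * q + - (p / d) * (- (q / d) * d))
   = (dotp x x * d - p * q) / d.
  by rewrite mulrBl; field.
by rewrite pmulr_lge0 ?invr_gt0// subr_ge0.
Qed.

Let nrmD x y : nrm (x + y) <= nrm x + nrm y.
Proof.
rewrite -ler_sqr ?nnegrE ?addr_ge0// sqrrD !sqrtCK Dl !Dr.
rewrite [leLHS](_ : _ = dotp x x + (dotp x y + dotp y x) + dotp y y); last by ring.
rewrite lerD2r lerD2l [dotp y x]dotpC.
have : `|dotp x y| *+ 2 <= (nrm x * nrm y) *+ 2 by rewrite lerMn2r CS.
apply: le_trans.
case: (dotp x y) => u v.
rewrite (_ : _ + _ = u%:C *+ 2)%C; last first.
  by apply/eqP; rewrite mulr2n eq_complex /= subrr addr0 !eqxx.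
rewrite lerMn2r/= normc_def lecR.
by rewrite (le_trans (ler_norm _))// -sqrtr_sqr ler_sqrt ?lerDl ?addr_ge0 ?sqr_ge0.
Qed.

Let nrmZ (l : R[i]) (x : H) : nrm (l *: x) = `|l| * nrm x.
Proof.
rewrite /nrm Zl Zr mulrA.
have -> : l * (l^*)%C = `|l| ^+ 2 by rewrite normCK; case: l.
by rewrite sqrtCM ?nnegrE ?exprn_ge0 ?dotp_ge0// sqrCK.
Qed.

Let nrm0 x : nrm x = 0 -> x = 0.
Proof. by move/eqP; rewrite sqrtC_eq0 => /eqP /dotp_eq0. Qed.

HB.instance Definition _ := Lmodule_isNormed.Build R[i] H nrmD nrmZ nrm0.

Let nrm2 x : dotp x x = `|x| ^+ 2. Proof. by rewrite [in RHS]/Num.norm/= sqrtCK. Qed.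

HB.instance Definition _ :=
  NormedModule_isInnerProduct.Build R H dotp_linearl dotpC nrm2.

HB.end.

Section complex_inner.
Variable R : realType.
Let dot (x y : R[i]^o) : R[i] := x * (y^*)%C.
Let dl z : scalar (dot ^~ z).
Proof. by move=> a x y; rewrite /dot mulrDl mulrA. Qed.
Let dC x y : dot x y = ((dot y x)^*)%C.
Proof. by rewrite /dot rmorphM /= conjcK mulrC. Qed.
Let d2 x : dot x x = `|x| ^+ 2.
Proof. by rewrite /dot normCK; case: x. Qed.
HB.instance Definition _ :=
  NormedModule_isInnerProduct.Build R R[i]^o dl dC d2.
End complex_inner.

(* The norm of an R[i]-normed module takes values in R[i]; nrm is the same norm
   seen as an element of R. *)
Definition nrm (R : realType) (H : normedModType R[i]) (h : H) : R :=
  complex.Re `|h|.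

Section nrm_theory.
Context (R : realType) (H : normedModType R[i]).
Implicit Types x y : H.

Lemma nrmE x : `|x| = (nrm x)%:C%C.
Proof.
have := normr_ge0 x; rewrite /nrm; case: (`|x|) => a b.
by rewrite lecE /= => /andP[/eqP -> _].
Qed.

Lemma nrm_ge0 x : 0 <= nrm x.
Proof. by rewrite -ler0c -nrmE normr_ge0. Qed.

Lemma nrm_eq0 x : (nrm x == 0) = (x == 0).
Proof. by rewrite -[RHS]normr_eq0 nrmE -(inj_eq (@complexI R)). Qed.

Lemma nrm0 : nrm (0 : H) = 0.
Proof. by apply/eqP; rewrite nrm_eq0. Qed.

Lemma nrmD x y : nrm (x + y) <= nrm x + nrm y.
Proof. by rewrite -lecR rmorphD /= -!nrmE ler_normD. Qed.

Lemma nrmN x : nrm (- x) = nrm x.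
Proof. by rewrite /nrm normrN. Qed.

Lemma nrm_dist x y : `|nrm x - nrm y| <= nrm (x - y).
Proof.
have h (a b : H) : nrm a - nrm b <= nrm (a - b).
  by rewrite lerBlDr -{1}(subrK b a) nrmD.
by rewrite ler_norml h andbT lerNl opprB -[leRHS]nrmN opprB h.
Qed.

Lemma nrmZ (a : R[i]) x : nrm (a *: x) ^+ 2 = nrm (a : R[i]^o) ^+ 2 * nrm x ^+ 2.
Proof.
apply: (@complexI R); rewrite -exprMn; congr (_ ^+ 2)%:C%C.
by apply: (@complexI R); rewrite rmorphM /= -!nrmE normrZ.
Qed.

Lemma cvg_nrm (u : H^nat) x :
  u n @[n --> \oo] --> x -> nrm (u n) @[n --> \oo] --> nrm x.
Proof.
move=> ux; apply/cvgrPdist_lt => e e0.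
have e0' : 0 < e%:C%C by rewrite -[0]/(0%:C%C) ltcR.
move/cvgrPdist_lt : ux => /(_ _ e0'); apply: filterS => n.
by rewrite nrmE ltcR; apply: le_lt_trans; exact: nrm_dist.
Qed.

End nrm_theory.

Section dotp_theory.
Context (R : realType) (H : innerProductType R).
Implicit Types x y z : H.

Lemma dotpDl x y z : dotp (x + y) z = dotp x z + dotp y z.
Proof. by have := dotp_linearl z 1 x y; rewrite scale1r mul1r. Qed.

Lemma dotp0l z : dotp 0 z = 0.
Proof. by apply: (addrI (dotp 0 z)); rewrite -dotpDl !addr0. Qed.

Lemma dotpZl a x z : dotp (a *: x) z = a * dotp x z.
Proof. by have := dotp_linearl z a x 0; rewrite dotp0l !addr0. Qed.

Lemma dotpDr x y z : dotp z (x + y) = dotp z x + dotp z y.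
Proof. by rewrite dotpC dotpDl rmorphD /= -!dotpC. Qed.

Lemma dotpZr a x z : dotp z (a *: x) = (a^*)%C * dotp z x.
Proof. by rewrite dotpC dotpZl rmorphM /= -dotpC. Qed.

Lemma dotp_nrm x : dotp x x = (nrm x ^+ 2)%:C%C.
Proof. by rewrite dotpp nrmE rmorphXn. Qed.

Lemma nrm2D x y :
  nrm (x + y) ^+ 2 = nrm x ^+ 2 + nrm y ^+ 2 + complex.Re (dotp x y) *+ 2.
Proof.
have := dotp_nrm (x + y); rewrite dotpDl !dotpDr !dotp_nrm [dotp y x]dotpC.
case: (dotp x y) => u v /(congr1 (@complex.Re R)) /= <-; ring.
Qed.

Lemma Re_dotp x y : complex.Re (dotp x y) =
  2^-1 * (nrm (x + y) ^+ 2 - nrm x ^+ 2 - nrm y ^+ 2).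
Proof. by rewrite nrm2D; field. Qed.

Lemma Im_dotp x y : complex.Im (dotp x y) = complex.Re (dotp x ('i%C *: y)).
Proof. by rewrite dotpZr; case: (dotp x y) => u v /=; ring. Qed.

Lemma nrm2i x : nrm ('i%C *: x) ^+ 2 = nrm x ^+ 2.
Proof.
rewrite nrmZ (_ : nrm _ ^+ 2 = 1) ?mul1r//.
by rewrite /nrm normc_def /= expr0n /= add0r expr1n sqrtr1 expr1n.
Qed.

Lemma Re_dotp_le x y : `|complex.Re (dotp x y)| <= nrm x ^+ 2 + nrm y ^+ 2.
Proof.
have h (z w : H) : - complex.Re (dotp z w) <= nrm z ^+ 2 + nrm w ^+ 2.
  have := sqr_ge0 (nrm (z + w)); rewrite nrm2D.
  have := sqr_ge0 (nrm z); have := sqr_ge0 (nrm w); lra.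
rewrite ler_norml lerNl h/=.
have := h (- x) y; rewrite nrmN -[- x]scaleN1r dotpZl.
by case: (dotp x y) => u v /=; rewrite oppr0 mul0r subr0 mulN1r opprK.
Qed.

Lemma Im_dotp_le x y : `|complex.Im (dotp x y)| <= nrm x ^+ 2 + nrm y ^+ 2.
Proof. by rewrite Im_dotp -(nrm2i y) Re_dotp_le. Qed.

Lemma nrm2D_le x y : nrm (x + y) ^+ 2 <= 3 * (nrm x ^+ 2 + nrm y ^+ 2).
Proof.
rewrite nrm2D; have := Re_dotp_le x y; rewrite ler_norml => /andP[_]; lra.
Qed.

End dotp_theory.

Definition simple_map d (T : measurableType d) (X : Type) (s : T -> X) :=
  finite_set (range s) /\ forall a, measurable (s @^-1` [set a]).

(* Bochner measurability: pointwise limit of measurable maps with finitely many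
   values. For a separable target (in particular R[i] and L^2 of a second
   countable group) this is equivalent to Borel and to weak measurability. *)
Definition strongly_measurable d (T : measurableType d) (H : topologicalType)
    (f : T -> H) :=
  exists s : (T -> H)^nat, (forall n, simple_map (s n)) /\
    forall x, s n x @[n --> \oo] --> f x.

Section strongly_measurable_theory.
Context d (T : measurableType d).

Lemma simple_map_preimage (X : Type) (s : T -> X) (A : set X) :
  simple_map s -> measurable (s @^-1` A).
Proof.
move=> [fs ms].
have -> : s @^-1` A = \bigcup_(a in range s `&` A) (s @^-1` [set a]).
  apply/seteqP; split => [x Ax|x [a [_ Aa] /= sxa]]; last by rewrite /= sxa.
  by exists (s x) => //; split => //; exists x.
elim/Pchoice : X => X in s A fs ms *.
by apply: fin_bigcup_measurable => //; exact: finite_setIl.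
Qed.

Lemma simple_map_comp (X Y : Type) (s : T -> X) (g : X -> Y) :
  simple_map s -> simple_map (g \o s).
Proof.
move=> ss; split=> [|a]; last by rewrite comp_preimage; exact: simple_map_preimage.
rewrite (_ : range _ = g @` range s); last by rewrite image_comp.
by apply: finite_image; exact: (proj1 ss).
Qed.

Lemma simple_map_pair (X Y : Type) (s : T -> X) (t : T -> Y) :
  simple_map s -> simple_map t -> simple_map (fun x => (s x, t x)).
Proof.
move=> ss st; split=> [|[a b]].
  apply: (@sub_finite_set _ _ (range s `*` range t)).
    by move=> _ [x _ <-] /=; split; exists x.
  by apply: finite_setX; [exact: (proj1 ss)|exact: (proj1 st)].
have -> : (fun x => (s x, t x)) @^-1` [set (a, b)] =
    s @^-1` [set a] `&` t @^-1` [set b].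
  by apply/seteqP; split => x /=; [move=> [-> ->]|move=> [-> ->]].
by apply: measurableI; [exact: (proj2 ss)|exact: (proj2 st)].
Qed.

Context (R : realType) (H : normedModType R[i]).

Lemma strongly_measurable_cst (h : H) : strongly_measurable (fun _ : T => h).
Proof.
exists (fun=> fun=> h); split=> [n|x]; last exact: cvg_cst.
split=> [|a].
  by apply: (@sub_finite_set _ _ [set h]) => // _ [x _ <-].
have [->|ah] := pselect (h = a).
  by rewrite (_ : _ @^-1` _ = setT)//; apply/seteqP; split.
by rewrite (_ : _ @^-1` _ = set0)//; apply/seteqP; split.
Qed.

Lemma strongly_measurableD (f g : T -> H) : strongly_measurable f ->
  strongly_measurable g -> strongly_measurable (f \+ g).
Proof.
move=> [s [ss sf]] [t [st tg]]; exists (fun n => s n \+ t n); split=> [n|x].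
  exact: (simple_map_comp (fun p => p.1 + p.2) (simple_map_pair (ss n) (st n))).
by apply: cvgD; [exact: sf|exact: tg].
Qed.

Lemma strongly_measurableZ (a : R[i]) (f : T -> H) : strongly_measurable f ->
  strongly_measurable (fun x => a *: f x).
Proof.
move=> [s [ss sf]]; exists (fun n x => a *: s n x); split=> [n|x].
  exact: (simple_map_comp (fun h => a *: h) (ss n)).
by apply: cvgZ; [exact: cvg_cst|exact: sf].
Qed.

Lemma measurable_nrm (f : T -> H) : strongly_measurable f ->
  measurable_fun setT (fun x => nrm (f x)).
Proof.
move=> [s [ss sf]].
apply: (@measurable_fun_cvg _ _ _ _ (fun n x => nrm (s n x))) => [n|x _].
  move=> _ A mA; rewrite setTI.
  rewrite (_ : _ @^-1` _ = (s n) @^-1` (@nrm R H @^-1` A))//.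
  exact: simple_map_preimage.
by apply: cvg_nrm; exact: sf.
Qed.

Lemma measurable_nrm2 (f : T -> H) : strongly_measurable f ->
  measurable_fun setT (fun x => nrm (f x) ^+ 2).
Proof. by move=> /measurable_nrm mf; exact: measurable_funX. Qed.

End strongly_measurable_theory.

Section dotp_measurable.
Context d (T : measurableType d) (R : realType) (H : innerProductType R).
Variables f g : T -> H.
Hypotheses (mf : strongly_measurable f) (mg : strongly_measurable g).

Lemma measurable_Re_dotp :
  measurable_fun setT (fun x => complex.Re (dotp (f x) (g x))).
Proof.
under eq_fun do rewrite Re_dotp.
apply: measurable_funM => //; apply: measurable_funB; last exact: measurable_nrm2.
apply: measurable_funB; last exact: measurable_nrm2.
by apply: measurable_nrm2; exact: strongly_measurableD.
Qed.

End dotp_measurable.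

Lemma measurable_Im_dotp d (T : measurableType d) (R : realType)
    (H : innerProductType R) (f g : T -> H) :
  strongly_measurable f -> strongly_measurable g ->
  measurable_fun setT (fun x => complex.Im (dotp (f x) (g x))).
Proof.
move=> mf mg; under eq_fun do rewrite Im_dotp.
by apply: measurable_Re_dotp => //; exact: strongly_measurableZ.
Qed.

Section L2fun.
Context d (T : measurableType d) (R : realType).
Variables (mu : {measure set T -> \bar R}) (H : innerProductType R).

Definition sq_integrable (f : T -> H) := strongly_measurable f /\
  (\int[mu]_x ((nrm (f x)) ^+ 2)%:E < +oo)%E.

Definition L2_pred : {pred T -> H} := fun f => `[< sq_integrable f >].

Lemma sq_integrableP f : sq_integrable f <-> strongly_measurable f /\
  mu.-integrable setT (fun x => ((nrm (f x)) ^+ 2)%:E).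
Proof.
split=> [[mf foo]|[mf /integrableP[_ foo]]]; split => //.
  apply/integrableP; split; first exact/measurable_EFinP/measurable_nrm2.
  by under eq_integral do rewrite /= ger0_norm ?sqr_ge0//.
by move: foo; under eq_integral do rewrite /= ger0_norm ?sqr_ge0//.
Qed.

Lemma L2_submod_closed : submod_closed L2_pred.
Proof.
split=> [|a f g /asboolP/sq_integrableP[mf fi] /asboolP/sq_integrableP[mg gi]].
  apply/asboolP; split; first exact: strongly_measurable_cst.
  by under eq_integral do rewrite /= nrm0 expr0n /=; rewrite integral0 ltry.
apply/asboolP/sq_integrableP.
have maf : strongly_measurable (a *: f) by exact: strongly_measurableZ.
have mafg : strongly_measurable (a *: f + g) by exact: strongly_measurableD.
split => //.
apply: (@le_integrable _ _ _ mu setT measurableT _ (fun x =>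
  (3%:E * ((nrm (a : R[i]^o) ^+ 2)%:E * (nrm (f x) ^+ 2)%:E +
           (nrm (g x) ^+ 2)%:E)))%E).
- exact/measurable_EFinP/measurable_nrm2.
- move=> x _; cbv beta; rewrite -(EFinM (_ ^+ 2)) -EFinD -EFinM !abse_EFin lee_fin ger0_norm ?sqr_ge0//.
  by rewrite (le_trans (nrm2D_le _ _))// nrmZ ler_norm.
- by apply: integrableZl => //; apply: integrableD => //; exact: integrableZl.
Qed.

HB.instance Definition _ := GRing.isSubmodClosed.Build R[i] (T -> H)%type L2_pred
  L2_submod_closed.

Record L2fun := MkL2fun { L2fun_val :> T -> H ; _ : L2fun_val \in L2_pred }.
HB.instance Definition _ := [isSub for L2fun_val].
HB.instance Definition _ := [Choice of L2fun by <:].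
HB.instance Definition _ := [SubChoice_isSubLmodule of L2fun by <:].

Lemma L2funDE (f g : L2fun) x : (f + g) x = f x + g x. Proof. by []. Qed.
Lemma L2funBE (f g : L2fun) x : (f - g) x = f x - g x. Proof. by []. Qed.
Lemma L2funZE a (f : L2fun) x : (a *: f) x = a *: f x. Proof. by []. Qed.

Definition L2_null : {pred L2fun} :=
  fun f => `[< {ae mu, forall x, f x = 0} >].

Lemma L2_null_zmod_closed : zmod_closed L2_null.
Proof.
split=> [|f g /asboolP f0 /asboolP g0]; apply/asboolP; first exact: aeW.
by move: g0; apply: filterS2 f0 => x f0 g0; rewrite L2funBE f0 g0 subrr.
Qed.
HB.instance Definition _ := GRing.isZmodClosed.Build L2fun L2_null
  L2_null_zmod_closed.

End L2fun.

Section L2.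
Context d (T : measurableType d) (R : realType).
Variables (mu : {measure set T -> \bar R}) (H : innerProductType R).
Local Notation F := (@L2fun d T R mu H).

Lemma L2fun_sq (f : F) : sq_integrable mu f.
Proof. by case: f => f fP; apply/asboolP; exact: fP. Qed.

(* L^2(mu; H): square integrable H-valued functions modulo equality mu-a.e.;
   H = R[i]^o gives the usual L^2(mu). *)
Definition L2 : Type := {quot @L2_null d T R mu H}.
HB.instance Definition _ := GRing.Zmodule.on L2.
HB.instance Definition _ := ZmodQuotient.on L2.

Local Open Scope quotient_scope.

Lemma L2_eqP (f g : F) : \pi_L2 f = \pi_L2 g <-> {ae mu, forall x, f x = g x}.
Proof.
split=> [/eqP|fg].
  rewrite -idealrBE => /asboolP; apply: filterS => x.
  by rewrite L2funBE => /eqP; rewrite subr_eq0 => /eqP.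
apply/eqP; rewrite -idealrBE; apply/asboolP; move: fg.
by apply: filterS => x fg; rewrite L2funBE fg subrr.
Qed.

(* A representative of the class f. *)
Definition L2_fun (f : L2) : T -> H := repr f.

Lemma L2_reprP (f : F) : {ae mu, forall x, L2_fun (\pi_L2 f) x = f x}.
Proof. by apply/L2_eqP; rewrite reprK. Qed.

Lemma L2_piP (v : L2) : exists f : F, v = \pi_L2 f.
Proof. by exists (repr v); rewrite reprK. Qed.

Let scale (a : R[i]) (f : L2) : L2 := \pi_L2 (a *: repr f).

Let scaleE a f : scale a (\pi_L2 f) = \pi_L2 (a *: f).
Proof.
apply/L2_eqP; have := L2_reprP f; by apply: filterS => x ffx; rewrite !L2funZE -ffx.
Qed.

Let piD f g : \pi_L2 f + \pi_L2 g = \pi_L2 (f + g).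
Proof. by rewrite piE. Qed.

Let sA a b v : scale a (scale b v) = scale (a * b) v.
Proof. by have [f ->] := L2_piP v; rewrite !scaleE scalerA. Qed.
Let s1 : left_id 1 scale.
Proof. by move=> v; have [f ->] := L2_piP v; rewrite scaleE scale1r. Qed.
Let sDr : right_distributive scale +%R.
Proof.
move=> a u v; have [f ->] := L2_piP v; have [g ->] := L2_piP u.
by rewrite piD !scaleE piD scalerDr.
Qed.
Let sDl v : {morph scale^~ v: a b / a + b}.
Proof. by move=> a b; have [f ->] := L2_piP v; rewrite !scaleE piD scalerDl. Qed.

HB.instance Definition _ := GRing.Zmodule_isLmodule.Build R[i] L2 sA s1 sDr sDl.

Lemma L2_piZ a (f : F) : a *: \pi_L2 f = \pi_L2 (a *: f).
Proof. exact: scaleE. Qed.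

Lemma L2_piD (f g : F) : \pi_L2 f + \pi_L2 g = \pi_L2 (f + g).
Proof. exact: piD. Qed.

Let cdot (f g : T -> H) : R[i] :=
  ((\int[mu]_x complex.Re (dotp (f x) (g x)))%R +i*
   (\int[mu]_x complex.Im (dotp (f x) (g x)))%R)%C.

Definition L2dot (f g : L2) : R[i] := cdot (repr f) (repr g).

Let cdotE (f g : F) : L2dot (\pi_L2 f) (\pi_L2 g) = cdot f g.
Proof.
have [[mf _] [mg _]] := (L2fun_sq f, L2fun_sq g).
have [[mf' _] [mg' _]] := (L2fun_sq (repr (\pi_L2 f)), L2fun_sq (repr (\pi_L2 g))).
have := L2_reprP f; have := L2_reprP g; rewrite /L2_fun => gg ff.
rewrite /L2dot /cdot /Rintegral.
congr (fine _ +i* fine _)%C; apply: ae_eq_integral => //;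
  try by apply/measurable_EFinP; (exact: measurable_Re_dotp || exact: measurable_Im_dotp).
- by move: ff gg; apply: filterS2 => x ff gg _ /=; rewrite ff gg.
- by move: ff gg; apply: filterS2 => x ff gg _ /=; rewrite ff gg.
Qed.

Let intRe (f g : F) :
  mu.-integrable setT (EFin \o (fun x => complex.Re (dotp (f x) (g x)))).
Proof.
have /sq_integrableP[mf fi] := L2fun_sq f; have /sq_integrableP[mg gi] := L2fun_sq g.
apply: le_integrable (integrableD measurableT fi gi) => //.
  by apply/measurable_EFinP; exact: measurable_Re_dotp.
move=> x _ /=; rewrite lee_fin (le_trans (Re_dotp_le _ _))//.
by rewrite ler_norm.
Qed.

Let intIm (f g : F) :
  mu.-integrable setT (EFin \o (fun x => complex.Im (dotp (f x) (g x)))).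
Proof.
apply: eq_integrable (intRe f ('i%C *: g)) => // x _ /=.
by rewrite Im_dotp.
Qed.

Let L2dot_linear z : scalar (L2dot ^~ z).
Proof.
move=> a x y; have [f ->] := L2_piP x; have [g ->] := L2_piP y.
have [{}z ->] := L2_piP z.
rewrite L2_piZ L2_piD !cdotE /cdot.
have ReE t : complex.Re (dotp ((a *: f + g) t) (z t)) =
    complex.Re a * complex.Re (dotp (f t) (z t)) +
    (- complex.Im a * complex.Im (dotp (f t) (z t)) +
    complex.Re (dotp (g t) (z t))).
  rewrite L2funDE L2funZE dotpDl dotpZl.
  move: (dotp (f t) _) (dotp (g t) _) => [? ?] [? ?]; clear.
  by case: a => ? ? /=; ring.
have ImE t : complex.Im (dotp ((a *: f + g) t) (z t)) =
    complex.Re a * complex.Im (dotp (f t) (z t)) +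
    (complex.Im a * complex.Re (dotp (f t) (z t)) +
    complex.Im (dotp (g t) (z t))).
  rewrite L2funDE L2funZE dotpDl dotpZl.
  move: (dotp (f t) _) (dotp (g t) _) => [? ?] [? ?]; clear.
  by case: a => ? ? /=; ring.
have iZ (r : R) (h : T -> R) : mu.-integrable setT (EFin \o h) ->
    mu.-integrable setT (EFin \o (fun t => r * h t)).
  by move=> ih; apply: eq_integrable (integrableZl measurableT r ih).
have iD (h k : T -> R) : mu.-integrable setT (EFin \o h) ->
    mu.-integrable setT (EFin \o k) ->
    mu.-integrable setT (EFin \o (fun t => h t + k t)).
  by move=> ih ik; apply: eq_integrable (integrableD measurableT ih ik).
under eq_Rintegral do rewrite ReE.
under [X in (_ +i* X)%C = _]eq_Rintegral do rewrite ImE.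
rewrite !RintegralD ?RintegralZl//; do ?[exact: intRe|exact: intIm|
  apply: iZ|apply: iD].
by apply/eqP; rewrite eq_complex /=; clear; case: a => p q /=; apply/andP; split; apply/eqP; ring.
Qed.

Let L2dotC x y : L2dot x y = ((L2dot y x)^*)%C.
Proof.
rewrite /L2dot /cdot; move: (repr x) (repr y) => f g.
apply/eqP; rewrite eq_complex /=; apply/andP; split; apply/eqP.
  by apply: eq_Rintegral => t _; rewrite dotpC; case: dotp.
rewrite -mulN1r -RintegralZl//.
by apply: eq_Rintegral => t _; rewrite dotpC mulN1r; case: dotp.
Qed.

Let L2dotxx (x : L2) :
  L2dot x x = ((\int[mu]_t (nrm (repr x t) ^+ 2))%R)%:C%C.
Proof.
rewrite /L2dot /cdot; apply/eqP; rewrite eq_complex /=; apply/andP; split; apply/eqP.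
  by apply: eq_Rintegral => t _; rewrite dotp_nrm.
under eq_Rintegral do rewrite dotp_nrm /=.
by rewrite Rintegral_cst// mul0r.
Qed.

Let L2dot_ge0 x : 0 <= L2dot x x.
Proof. by rewrite L2dotxx ler0c; apply: Rintegral_ge0 => t _; exact: sqr_ge0. Qed.

Let L2dot_eq0 x : L2dot x x = 0 -> x = 0.
Proof.
rewrite L2dotxx => x0; have {x0} := congr1 (@complex.Re R) x0; rewrite /=.
have /sq_integrableP[mf fi] := L2fun_sq (repr x).
move=> i0; have {i0} := congr1 EFin i0.
rewrite /Rintegral fineK; last exact: integrable_fin_num.
move=> i0.
have nx : ae_eq mu setT (fun t => ((nrm (repr x t) ^+ 2)%:E)) (cst 0%E).
  apply/ae_eq_integral_abs => //; first by have /integrableP[] := fi.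
  by under eq_integral do rewrite gee0_abs ?lee_fin ?sqr_ge0//.
rewrite -[x]reprK (_ : 0 = \pi_L2 (0 : F)); last by rewrite piE.
apply/L2_eqP; apply: filterS nx => t /(_ I) /= [] /eqP.
by rewrite sqrf_eq0 nrm_eq0 => /eqP.
Qed.

HB.instance Definition _ := Lmodule_isInnerProduct.Build R L2
  L2dot_linear L2dotC L2dot_ge0 L2dot_eq0.

Lemma L2_dotE (x y : L2) : dotp x y =
  ((\int[mu]_t complex.Re (dotp (L2_fun x t) (L2_fun y t)))%R +i*
   (\int[mu]_t complex.Im (dotp (L2_fun x t) (L2_fun y t)))%R)%C.
Proof. by []. Qed.

End L2.

(* The class of f when f is square integrable, and 0 otherwise. *)
Definition toL2 d (T : measurableType d) (R : realType)
    (mu : {measure set T -> \bar R}) (H : innerProductType R) (f : T -> H) :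
    L2 mu H :=
  (\pi_(L2 mu H) (insubd (0 : L2fun mu H) f))%qT.

Lemma toL2P d (T : measurableType d) (R : realType)
    (mu : {measure set T -> \bar R}) (H : innerProductType R) (f : T -> H) :
  sq_integrable mu f -> {ae mu, forall x, L2_fun (toL2 mu f) x = f x}.
Proof.
move=> fi; have fP : f \in @L2_pred d T R mu H by exact/asboolP.
have := L2_reprP (insubd (0 : L2fun mu H) f); apply: filterS => x ->.
by have -> : insubd (0 : L2fun mu H) f = f :> (T -> H) by rewrite insubdK.
Qed.

Notation topGroupType := PreTopologicalZmodule.type.

(* measurableType requires a pointed carrier; groups are pointed at 0. *)
Definition pointed_at0 (A : topGroupType) : Type := A.
HB.instance Definition _ (A : topGroupType) :=
  Topological.copy (pointed_at0 A) A.
HB.instance Definition _ (A : topGroupType) :=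
  isPointed.Build (pointed_at0 A) (0 : A).

(* X with its Borel sigma-algebra. *)
Definition borel (X : ptopologicalType) : Type := g_sigma_algebraType (@open X).
HB.instance Definition _ (X : ptopologicalType) := Measurable.on (borel X).

Notation gborel A := (borel (pointed_at0 A)).

Section quotient_group.
Context (A : topGroupType) (B : zmodClosed A).
(* A/B with the quotient topology. *)
Definition quotient_group : Type := {quot B}.
HB.instance Definition _ := GRing.Zmodule.on quotient_group.
HB.instance Definition _ := ZmodQuotient.on quotient_group.

Let quot_open : set_system quotient_group :=
  fun U => open (\pi_quotient_group%qT @^-1` U : set A).
Let quot_openT : quot_open setT.
Proof. by rewrite /quot_open preimage_setT; exact: openT. Qed.
Let quot_openI : setI_closed quot_open.
Proof. by move=> U V oU oV; exact: openI. Qed.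
Let quot_open_bigcup (I : Type) (f : I -> set quotient_group) :
  (forall i, quot_open (f i)) -> quot_open (\bigcup_i f i).
Proof. by move=> fo; apply: bigcup_open => i _; exact: fo. Qed.
HB.instance Definition _ := isOpenTopological.Build quotient_group
  quot_openT quot_openI quot_open_bigcup.
End quotient_group.

Section dual.
Context (R : realType) (G : topGroupType).

Definition is_character (chi : G -> R[i]^o) : Prop :=
  [/\ continuous chi, forall x y, chi (x + y) = chi x * chi y &
      forall x, `|chi x| = 1].

Definition character_pred : {pred G -> R[i]^o} := fun chi => `[< is_character chi >].

(* The dual group, written additively (so chi - psi is x |-> chi x / psi x), with
   the compact-open topology. *)
Record dual := Character {
  character_fun :> G -> R[i]^o ; _ : character_fun \in character_pred }.
HB.instance Definition _ := [isSub for character_fun].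
HB.instance Definition _ := [Choice of dual by <:].

Lemma dualP (chi : dual) : is_character chi.
Proof. by case: chi => chi chiP; apply/asboolP; exact: chiP. Qed.

Lemma dual_eqP (chi psi : dual) : (forall x, chi x = psi x) -> chi = psi.
Proof. by move=> e; apply: val_inj; apply: funext. Qed.

Let one_subproof : (fun _ : G => 1 : R[i]^o) \in character_pred.
Proof.
apply/asboolP; split=> [|x y|x]; [exact: cst_continuous|by rewrite mulr1|].
exact: normr1.
Qed.

Let mul_subproof (chi psi : dual) :
  (fun x : G => chi x * psi x : R[i]^o) \in character_pred.
Proof.
have [cc cD c1] := dualP chi; have [pc pD p1] := dualP psi.
apply/asboolP; split=> [x|x y|x].
- by apply: cvgM; [exact: cc|exact: pc].
- by rewrite cD pD mulrACA.
- by rewrite normrM c1 p1 mulr1.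
Qed.

Let inv_subproof (chi : dual) : (fun x : G => (chi x)^-1 : R[i]^o) \in character_pred.
Proof.
have [cc cD c1] := dualP chi.
apply/asboolP; split=> [x|x y|x].
- apply: cvgV; last exact: cc.
  by rewrite -normr_eq0 c1 oner_eq0.
- by rewrite cD invfM.
- by rewrite normfV c1 invr1.
Qed.

Let one : dual := Character one_subproof.
Let mul (chi psi : dual) : dual := Character (mul_subproof chi psi).
Let inv (chi : dual) : dual := Character (inv_subproof chi).

Let mulA : associative mul.
Proof. by move=> x y z; apply: dual_eqP => t; exact: mulrA. Qed.
Let mulC : commutative mul.
Proof. by move=> x y; apply: dual_eqP => t; exact: mulrC. Qed.
Let mul1 : left_id one mul.
Proof. by move=> x; apply: dual_eqP => t; exact: mul1r. Qed.
Let mulV : left_inverse one inv mul.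
Proof.
move=> x; apply: dual_eqP => t; apply: mulVf.
by have [_ _ x1] := dualP x; rewrite -normr_eq0 x1 oner_eq0.
Qed.

HB.instance Definition _ := GRing.isZmodule.Build dual mulA mulC mul1 mulV.

Definition dual_to_compact_open (chi : dual) : {compact-open, G -> R[i]^o} := chi.
HB.instance Definition _ :=
  Topological.copy dual (initial_topology dual_to_compact_open).

Lemma dual0E x : (0 : dual) x = 1. Proof. by []. Qed.
Lemma dualBE (chi psi : dual) x : (chi - psi) x = chi x / psi x. Proof. by []. Qed.

End dual.

Section annihilator.
Context (R : realType) (G : topGroupType) (Gamma : zmodClosed G).
Definition annihilator : {pred dual R G} :=
  fun chi => `[< forall g, g \in Gamma -> chi g = 1 >].
Lemma annihilator_zmod_closed : zmod_closed annihilator.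
Proof.
split=> [|chi psi /asboolP c1 /asboolP p1]; apply/asboolP => // g gG.
by rewrite dualBE c1// p1// invr1 mulr1.
Qed.
HB.instance Definition _ := GRing.isZmodClosed.Build (dual R G) annihilator
  annihilator_zmod_closed.
End annihilator.
Arguments annihilator R {G} Gamma.

Section section.
Context (A : topGroupType) (B : zmodClosed A).

(* A Borel set of representatives of the cosets of B in A. *)
Record borel_section := BorelSection {
  section_set : set A ;
  section_measurable : measurable (section_set : set (gborel A)) ;
  section_unique : forall x : A, exists! s, section_set s /\ x - s \in B }.

(* The section itself as a space; its Borel sets are the traces of the Borel sets
   of A. *)
Definition section_type (S : borel_section) : Type := set_type (section_set S).
HB.instance Definition _ (S : borel_section) :=
  Topological.copy (section_type S) (set_type (section_set S)).

Lemma section_inhabited (S : borel_section) : exists s : section_type S, True.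
Proof.
have [s [[Ss _] _]] := section_unique S 0.
by exists (exist _ s (mem_set Ss)).
Qed.
HB.instance Definition _ (S : borel_section) :=
  isPointed.Build (section_type S) (sval (cid (section_inhabited S))).

(* The canonical bijection from the section to A/B. *)
Definition section_coset (S : borel_section) (s : borel (section_type S)) :
  gborel (quotient_group B) :=
  (\pi_(quotient_group B) (set_val (s : section_type S)))%qT.

End section.

(* Non-zero translation invariant Radon measure. Local finiteness is the form of
   "finite on compact sets" used here; both agree on locally compact groups. *)
Definition haar_measure (R : realType) (A : topGroupType)
    (mu : {measure set (gborel A) -> \bar R}) :=
  [/\ (mu setT != 0)%E,
      forall (a : A) (B : set A), measurable (B : set (gborel A)) ->
        mu ((fun x : A => x + a) @^-1` B) = mu B,
      forall a : A, exists U : set A, [/\ open U, U a & (mu U < +oo)%E] &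
      forall B : set A, measurable (B : set (gborel A)) ->
        mu B = ereal_sup [set mu K | K in [set K : set A | compact K /\ K `<=` B]]].

(* The section carries the measure of A/B, for some Haar measure nu of A/B (its
   normalization is left free): m is transported to nu by the canonical
   bijection. In the Polish setting that bijection is a Borel isomorphism, so
   this determines m on all Borel sets. *)
Definition section_haar_measure (R : realType) (A : topGroupType)
    (B : zmodClosed A) (S : borel_section B)
    (m : {measure set (borel (section_type S)) -> \bar R}) : Prop :=
  exists2 nu : {measure set (gborel (quotient_group B)) -> \bar R},
    haar_measure nu &
    forall U, measurable U -> m (@section_coset A B S @^-1` U) = nu U.

Section operators.
Context (R : realType) (H H' : innerProductType R).

Definition closed_subspace (V : set H) : Prop :=
  [/\ V 0, forall (a : R[i]) x y, V x -> V y -> V (a *: x + y) & closed V].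

(* An operator with domain the subspace V is a total function T of which only the
   restriction to V matters. *)
Definition bounded_linear_on (V : set H) (T : H -> H') : Prop :=
  (forall (a : R[i]) x y, V x -> V y -> T (a *: x + y) = a *: T x + T y) /\
  exists M : R, forall x, V x -> nrm (T x) <= M * nrm x.

Definition compact_on (V : set H) (T : H -> H') : Prop :=
  precompact (T @` [set x | V x /\ nrm x <= 1]).

Definition orthonormal_basis (V E : set H) : Prop :=
  [/\ E `<=` V, forall x, E x -> nrm x = 1,
      forall x y, E x -> E y -> x <> y -> dotp x y = 0 &
      forall x, V x -> (forall e, E e -> dotp x e = 0) -> x = 0].

(* The sum does not depend on the orthonormal basis E. *)
Definition hilbert_schmidt_on (V : set H) (T : H -> H') : Prop :=
  exists2 E, orthonormal_basis V E &
    (\esum_(x in E) (nrm (T x) ^+ 2)%:E < +oo)%E.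

(* Orthogonal projection; the defining set is a singleton when V is a closed
   subspace of a complete space. *)
Definition orthproj (V : set H) (x : H) : H :=
  xget 0 [set p | V p /\ forall q, V q -> dotp (x - p) q = 0].

End operators.

Section positive_operators.
Context (R : realType) (H : innerProductType R).

Definition positive_on (V : set H) (T : H -> H) : Prop :=
  forall x, V x -> 0 <= dotp (T x) x.

(* Meant for T positive on V: the terms are then nonnegative reals and the trace
   does not depend on E. *)
Definition finite_trace_on (V : set H) (T : H -> H) : Prop :=
  exists2 E, orthonormal_basis V E &
    (\esum_(x in E) (complex.Re (dotp (T x) x))%:E < +oo)%E.

End positive_operators.

Definition complex_measurable d (T : measurableType d) (R : realType)
    (f : T -> R[i]) : Prop :=
  measurable_fun setT (fun x => complex.Re (f x)) /\
  measurable_fun setT (fun x => complex.Im (f x)).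

Section range_functions.
Context d (T : measurableType d) (R : realType).
Context (mu : {measure set T -> \bar R}) (K : innerProductType R).

Definition measurable_range_function (J : T -> set K) : Prop :=
  (forall w, closed_subspace (J w)) /\
  forall a b, complex_measurable (fun w => dotp (orthproj (J w) a) b).

(* S w has to be a bounded linear operator for almost every w only. *)
Definition measurable_range_operator (J : T -> set K) (S : T -> K -> K) : Prop :=
  {ae mu, forall w, bounded_linear_on (J w) (S w)} /\
  forall a b, complex_measurable (fun w => dotp (S w (orthproj (J w) a)) b).

End range_functions.

Section translations.
Context (R : realType) (G : topGroupType) (Gamma : zmodClosed G).
Context (mG : {measure set (gborel G) -> \bar R}).
Local Notation L2G := (L2 mG R[i]^o).

Definition translate (g : G) (f : L2G) : L2G :=
  toL2 mG (fun x : gborel G => L2_fun f ((x : G) - g : G)).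

Definition translation_invariant (V : set L2G) : Prop :=
  closed_subspace V /\
  forall g, g \in Gamma -> forall f, V f -> V (translate g f).

Definition translation_preserving (V : set L2G) (U : L2G -> L2G) : Prop :=
  bounded_linear_on V U /\
  forall g, g \in Gamma -> forall f, V f ->
    U (translate g f) = translate g (U f).

Context (Omega : borel_section (annihilator R Gamma)).
Context (mO : {measure set (borel (section_type Omega)) -> \bar R}).
Context (K : innerProductType R).

Definition mul_character (g : G) (F : L2 mO K) : L2 mO K :=
  toL2 mO (fun w : borel (section_type Omega) =>
    (set_val (w : section_type Omega) : dual R G) g *: L2_fun F w).

End translations.

(* Main.v *)
(** Read through [Z], the operator [U] acts fibrewise by [S w]. For a set [A]
    of finite measure and a Hilbert basis [a_n] of the fibre space, the fields
    [1_A(w) P_J(w) a_n] form a Bessel family in [V] with bound [mu A]. For a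
    positive form [q], the sum of [q] over a Bessel family is bounded by the
    Bessel bound times the trace of [q]. With [q x y = <U x, U y>] (resp.
    [<U x, y>]) this makes the integral over [A] of the trace of the fibre form
    finite, so that trace is finite almost everywhere on [A]; finally [Omega] is
    covered by countably many such [A]. *)

Require Import Defs.
From HB Require Import structures.
From mathcomp Require Import all_boot all_order all_algebra.
From mathcomp Require Import complex ring lra.
From mathcomp Require Import all_classical all_reals all_analysis.
From mathcomp Require Import measurable_realfun.

Set Implicit Arguments.
Unset Strict Implicit.
Unset Printing Implicit Defensive.

Import Order.TTheory GRing.Theory Num.Theory numFieldNormedType.Exports.

Local Open Scope classical_set_scope.
Local Open Scope ring_scope.

(** * Inner product spaces and hermitian forms *)

(** Nothing in [V] is adapted to the fibres: the dimension of [J w] may vary with [w], and an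
    orthonormal basis of [V] does not in general restrict to bases of the [J w]. The projections of
    a fixed basis of the fibre space form no basis either, but a Bessel bound survives projection;
    this is why the trace inequality is stated for Bessel families. The same inequality, with bound
    1, then passes from the vectors P_J(w) a_n to an orthonormal basis of [J w], so that
    independence of the trace from the basis is never established separately. Splitting off rank one
    forms proves the inequality without adjoints or square roots of operators. Measurability is the
    second obstacle: the fibre form is read off the representatives of [Z (U f)] and [Z f], which
    are measurable by construction. Finally, exceptional null sets depend on the vectors tested, so
    each a.e. statement is reduced to countably many; for the positivity of [S w] the test vectors
    are rational combinations of the a_n. *)

Lemma eventually_inv_lt (R : realType) (e : R) : 0 < e ->
  exists N, forall n, (N <= n)%N -> n.+1%:R^-1 < e.
Proof.
move=> e0; exists (Num.truncn e^-1) => n Nn.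
rewrite -[ltRHS]invrK ltf_pV2 ?posrE ?invr_gt0// (lt_le_trans (truncnS_gt _))//.
by rewrite ler_nat.
Qed.

(** The squared modulus is kept in [R], whereas the norm of [R[i]] takes complex values; estimates
    then stay within real arithmetic. *)
Definition csq (R : realType) (z : R[i]) : R :=
  complex.Re z ^+ 2 + complex.Im z ^+ 2.

Section csq_theory.
Variable R : realType.
Implicit Types z w : R[i].

Lemma csq_ge0 z : 0 <= csq z.
Proof. by rewrite addr_ge0// sqr_ge0. Qed.

Lemma csqE z : z * (z^*)%C = (csq z)%:C%C.
Proof.
by case: z => a b; apply/eqP; rewrite eq_complex /csq /=; apply/andP; split;
  apply/eqP; ring.
Qed.

Lemma csqM z w : csq (z * w) = csq z * csq w.
Proof. by case: z w => [a b] [c d]; rewrite /csq /=; ring. Qed.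

Lemma csqJ z : csq (z^*)%C = csq z.
Proof. by case: z => a b; rewrite /csq /= sqrrN. Qed.

Lemma csqN z : csq (- z) = csq z.
Proof. by case: z => a b; rewrite /csq /= !sqrrN. Qed.

Lemma csq_real (r : R) : csq r%:C%C = r ^+ 2.
Proof. by rewrite /csq /= expr0n addr0. Qed.

Lemma csq0 : csq (0 : R[i]) = 0.
Proof. by rewrite csq_real expr0n. Qed.

Lemma csq1 : csq (1 : R[i]) = 1.
Proof. by rewrite csq_real expr1n. Qed.

Lemma csq_eq0 z : (csq z == 0) = (z == 0).
Proof. by rewrite paddr_eq0 ?sqr_ge0// !sqrf_eq0 eq_complex. Qed.

Lemma nrm_csq z : nrm (z : R[i]^o) ^+ 2 = csq z.
Proof.
by rewrite /nrm normc_def /= sqr_sqrtr ?addr_ge0 ?sqr_ge0//.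
Qed.

Lemma ReM_real (r : R) z : complex.Re (r%:C%C * z) = r * complex.Re z.
Proof. by case: z => a b /=; rewrite mul0r subr0. Qed.

End csq_theory.

Section nrm_distance.
Context (R : realType) (H : normedModType R[i]).
Implicit Types x y z : H.

Lemma nrm_dist_le x y z : nrm (x - z) <= nrm (x - y) + nrm (y - z).
Proof. by rewrite -[x - z](subrKA y) nrmD. Qed.

Lemma nrmBC x y : nrm (x - y) = nrm (y - x).
Proof. by rewrite -nrmN opprB. Qed.

End nrm_distance.

Section inner_product_space.
Context (R : realType) (H : innerProductType R).
Implicit Types (x y z : H) (V E : set H).

Definition lin_closed V :=
  V 0 /\ forall (a : R[i]) x y, V x -> V y -> V (a *: x + y).

Lemma lin_closedT : lin_closed [set: H]. Proof. by []. Qed.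

Lemma lin_closedD V x y : lin_closed V -> V x -> V y -> V (x + y).
Proof. by move=> [_ lV] Vx Vy; rewrite -[x]scale1r; exact: lV. Qed.

Lemma lin_closedZ V a x : lin_closed V -> V x -> V (a *: x).
Proof. by move=> [V0 lV] Vx; rewrite -[_ *: _]addr0; exact: lV. Qed.

Lemma lin_closedB V x y : lin_closed V -> V x -> V y -> V (x - y).
Proof. by move=> lV Vx Vy; rewrite addrC -scaleN1r; exact: (lV.2). Qed.

Lemma lin_closed_sum V (I : Type) (r : seq I) (P : pred I) (F : I -> H) :
  lin_closed V -> (forall i, P i -> V (F i)) -> V (\sum_(i <- r | P i) F i).
Proof.
move=> lV VF; elim/big_ind : _ => //; [exact: lV.1|move=> x y; exact: lin_closedD].
Qed.

(** Completeness is not part of [innerProductType]; it is carried as this hypothesis, in terms of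
    the real-valued norm, and supplied for L^2 by [L2_complete]. *)
Definition seq_complete :=
  forall u : nat -> H,
    (forall e : R, 0 < e -> exists N, forall m n, (N <= m)%N -> (N <= n)%N ->
      nrm (u m - u n) < e) ->
    exists l, forall e : R, 0 < e -> exists N, forall n, (N <= n)%N ->
      nrm (u n - l) < e.

Definition adh_closed V :=
  forall x, (forall e : R, 0 < e -> exists2 v, V v & nrm (x - v) < e) -> V x.

(** Balls have their radius in [R[i]]; a positive radius has zero imaginary part, so real radii
    suffice. *)
Lemma closed_adh V : closed V -> adh_closed V.
Proof.
move=> cV x xV; apply: cV => B /nbhs_ballP[e /= e0 eB].
have [er ei] : 0 < complex.Re e /\ complex.Im e = 0.
  by move: e0; case: (e) => a b; rewrite ltcE /= => /andP[/eqP -> ->].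
have [v Vv xv] := xV _ er.
exists v; split => //; apply: eB; rewrite -ball_normE /= nrmE.
by move: xv er ei; case: (e) => a b /= xv _ ->; rewrite ltcR.
Qed.

Lemma dotpNl x y : dotp (- x) y = - dotp x y.
Proof. by rewrite -scaleN1r dotpZl mulN1r. Qed.
Lemma dotpNr x y : dotp x (- y) = - dotp x y.
Proof. by rewrite dotpC dotpNl rmorphN /= -dotpC. Qed.
Lemma dotpBl x y z : dotp (x - y) z = dotp x z - dotp y z.
Proof. by rewrite dotpDl dotpNl. Qed.
Lemma dotpBr x y z : dotp z (x - y) = dotp z x - dotp z y.
Proof. by rewrite dotpDr dotpNr. Qed.
Lemma dotp0r x : dotp x 0 = 0.
Proof. by rewrite dotpC dotp0l rmorph0. Qed.
Lemma dotp_suml (I : Type) (r : seq I) (P : pred I) (F : I -> H) z :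
  dotp (\sum_(i <- r | P i) F i) z = \sum_(i <- r | P i) dotp (F i) z.
Proof.
by apply: (big_morph (dotp^~ z)) => [x y|]; rewrite ?dotp0l ?dotpDl.
Qed.
Lemma dotp_sumr (I : Type) (r : seq I) (P : pred I) (F : I -> H) z :
  dotp z (\sum_(i <- r | P i) F i) = \sum_(i <- r | P i) dotp z (F i).
Proof.
by apply: (big_morph (dotp z)) => [x y|]; rewrite ?dotp0r ?dotpDr.
Qed.

Lemma nrm2Z (a : R[i]) x : nrm (a *: x) ^+ 2 = csq a * nrm x ^+ 2.
Proof. by rewrite nrmZ nrm_csq. Qed.

(** All conditions are relative to [V], because an operator on [V] is a total function that is
    meaningful on [V] only. Boundedness makes the functionals [q x b] continuous, hence determined
    by their values on an orthonormal basis. *)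
Record psd_form V (q : H -> H -> R[i]) := PsdForm {
  form_lin : forall a x y z, V x -> V y -> V z ->
    q (a *: x + y) z = a * q x z + q y z;
  form_herm : forall x y, V x -> V y -> q x y = ((q y x)^*)%C;
  form_ge0 : forall x, V x -> 0 <= complex.Re (q x x);
  form_bounded : exists M : R, forall x, V x ->
    complex.Re (q x x) <= M * nrm x ^+ 2 }.

Section form_theory.
Context V (q : H -> H -> R[i]) (lV : lin_closed V) (qP : psd_form V q).

Lemma form_real x : V x -> q x x = (complex.Re (q x x))%:C%C.
Proof.
move=> Vx; have /eqP := form_herm qP Vx Vx.
case: (q x x) => a b; rewrite eq_complex /= => /andP[_ /eqP b0].
by congr (_ +i* _)%C; move: b0; lra.
Qed.

Lemma form_expand c x y : V x -> V y ->
  complex.Re (q (c *: y + x) (c *: y + x)) =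
  complex.Re (q x x) + complex.Re ((c^*)%C * q x y) *+ 2 +
  csq c * complex.Re (q y y).
Proof.
move=> Vx Vy; have Vxy : V (c *: y + x) by exact: lV.2.
rewrite (form_lin qP)// [q y _](form_herm qP)// [q x _](form_herm qP)//.
rewrite !(form_lin qP)// [q y x](form_herm qP)// (form_real Vx) (form_real Vy).
move: (q x y) (complex.Re (q x x)) (complex.Re (q y y)) => [a b] u v.
by case: c {Vxy} => c d; rewrite /csq /=; ring.
Qed.

(** Positivity at x - t q(x,y) y for real t. For d > 0 the choice t = 1/d is optimal; for d = 0 the
    expression is affine in t and has to be constant. *)
Lemma form_CS x y : V x -> V y ->
  csq (q x y) <= complex.Re (q x x) * complex.Re (q y y).
Proof.
move=> Vx Vy; set s := csq _; set A := complex.Re (q x x).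
set d := complex.Re (q y y).
have d0 : 0 <= d by exact: (form_ge0 qP).
have A0 : 0 <= A by exact: (form_ge0 qP).
have s0 : 0 <= s by exact: csq_ge0.
have key (t : R) : 0 <= A - t * s *+ 2 + t ^+ 2 * s * d.
  have := form_ge0 qP (lV.2 (- t%:C%C * q x y) _ _ Vy Vx).
  rewrite form_expand// csqM csqN csq_real -/s -/d -/A.
  suff -> : complex.Re ((- t%:C%C * q x y)^*%C * q x y) = - (t * s).
    by rewrite mulNrn.
  by rewrite /s /csq; case: (q x y) => a b /=; ring.
have [d00|dp] := eqVneq d 0.
  have [->|sp] := eqVneq s 0; first by rewrite d00 mulr0.
  (* This t makes the expression equal to -1. *)
  have := key ((A + 1) / (s *+ 2)); rewrite d00 mulr0 addr0.
  have -> : (A + 1) / (s *+ 2) * s *+ 2 = A + 1 by field.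
  lra.
have {d0}dp : 0 < d by rewrite lt_def dp.
have := key d^-1.
have -> : A - d^-1 * s *+ 2 + d^-1 ^+ 2 * s * d = (A * d - s) / d.
  by field; rewrite gt_eqF.
by rewrite pmulr_lge0 ?invr_gt0// subr_ge0.
Qed.

End form_theory.

Lemma psd_dotp : psd_form [set: H] (@dotp R H).
Proof.
split=> //; [by move=> *; rewrite dotpDl dotpZl|by move=> *; rewrite dotpC| |].
  by move=> x _; rewrite dotp_nrm sqr_ge0.
by exists 1 => x _; rewrite dotp_nrm mul1r.
Qed.

Lemma dotp_CS x y : csq (dotp x y) <= nrm x ^+ 2 * nrm y ^+ 2.
Proof.
have := @form_CS _ _ lin_closedT psd_dotp x y I I.
by rewrite !dotp_nrm.
Qed.

Lemma nrm2_expand c x y : nrm (c *: y + x) ^+ 2 =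
  nrm x ^+ 2 + complex.Re ((c^*)%C * dotp x y) *+ 2 + csq c * nrm y ^+ 2.
Proof.
have := @form_expand _ _ lin_closedT psd_dotp c x y I I.
by rewrite !dotp_nrm.
Qed.

(** The form used for nearest points: two almost nearest points [u], [v] of a subspace are close to
    each other, since their midpoint is no nearer to [x] than the infimum allows. *)
Lemma parallelogram x u v :
  nrm (u - v) ^+ 2 + 4 * nrm (x - 2^-1%:C%C *: (u + v)) ^+ 2 =
  2 * nrm (x - u) ^+ 2 + 2 * nrm (x - v) ^+ 2.
Proof.
have pl (y z : H) :
    nrm (y - z) ^+ 2 + nrm (y + z) ^+ 2 = 2 * nrm y ^+ 2 + 2 * nrm z ^+ 2.
  rewrite !nrm2D nrmN dotpNr; case: (dotp y z) => a b /=; ring.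
rewrite -pl; congr (_ + _).
  by rewrite opprB [_ + (v - x)]addrC subrKA nrmBC.
rewrite (_ : 4 = csq (2%:R%:C%C : R[i])); last by rewrite csq_real; ring.
rewrite -nrm2Z; congr (nrm _ ^+ 2).
rewrite scalerBr scalerA -rmorphM /= divff ?pnatr_eq0// scale1r.
rewrite rmorph_nat scaler_nat mulr2n opprD addrACA; congr (_ + _).
Qed.

End inner_product_space.

(** * Orthogonal projections and orthonormal bases *)

Section projection.
Context (R : realType) (H : innerProductType R) (H_complete : seq_complete H).
Implicit Types (x y z : H) (V E : set H).

Lemma dist_minimizer V x : lin_closed V -> adh_closed V ->
  exists2 p, V p & forall v, V v -> nrm (x - p) <= nrm (x - v).
Proof.
move=> lV cV.
pose D := [set nrm (x - v) ^+ 2 | v in V].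
have D0 : D !=set0 by exists (nrm (x - 0) ^+ 2), 0 => //; exact: lV.1.
have Dlb : lbound D 0 by move=> _ [v _ <-]; exact: sqr_ge0.
have hD : has_inf D by split => //; exists 0.
pose I : R := inf D.
have I_le v : V v -> I <= nrm (x - v) ^+ 2.
  by move=> Vv; apply: ge_inf; [exists 0|exists v].
have [r [r0 small]] : exists r : nat -> R, (forall n, 0 < r n) /\
    forall e, 0 < e -> exists N, forall n, (N <= n)%N -> r n < e.
  exists (fun n => n.+1%:R^-1); split=> [n|e e0]; first by rewrite invr_gt0.
  exact: eventually_inv_lt.
have uex (n : nat) : exists v, V v /\ nrm (x - v) ^+ 2 < I + r n.
  by have [_ [v Vv <-] vI] := inf_adherent (r0 n) hD; exists v.
have [u uP] := choice uex.
(* The midpoint of [u m] and [u n] lies in [V], so its squared distance to [x] is at least [I]; the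
   terms 4 I cancel. *)
have ucauchy m n : nrm (u m - u n) ^+ 2 <= 2 * r m + 2 * r n.
  have [Vm um] := uP m; have [Vn un] := uP n.
  have := parallelogram x (u m) (u n).
  have := I_le _ (lin_closedZ (2^-1%:C%C) lV (lin_closedD lV Vm Vn)); lra.
have [|p up] := H_complete (u := u).
  move=> e e0; have [N NP] := small (e ^+ 2 / 4) ltac:(by rewrite divr_gt0 ?exprn_gt0).
  exists N => m n Nm Nn.
  rewrite -(ltr_pXn2r (n := 2))// ?nnegrE ?nrm_ge0 ?(ltW e0)//.
  have := ucauchy m n; have := NP m Nm; have := NP n Nn; lra.
have Vp : V p.
  apply: cV => e e0; have [N NP] := up e e0.
  by exists (u N); [exact: (uP N).1|rewrite nrmBC; exact: NP].
exists p => // v Vv; apply/ler_addgt0Pr => e e0.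
have [N1 N1P] := up (e / 2) ltac:(by rewrite divr_gt0).
(* The excess [r n] over the infimum is absorbed by the term (e/2)^2 of the expanded square of |x -
   v| + e/2. *)
have [N2 N2P] := small (e ^+ 2 / 4) ltac:(by rewrite divr_gt0 ?exprn_gt0).
set n := maxn N1 N2.
have := N1P n (leq_maxl _ _); have := N2P n (leq_maxr _ _).
have [_] := uP n; have := I_le v Vv; have := nrm_dist_le x (u n) p.
move=> h1 h2 h3 h4 h5.
have h6 : nrm (x - u n) <= nrm (x - v) + e / 2.
  rewrite -(ler_pXn2r (n := 2))// ?nnegrE ?nrm_ge0 ?addr_ge0 ?nrm_ge0 ?divr_ge0 ?(ltW e0)//.
  have : 0 <= nrm (x - v) * (e / 2) by rewrite mulr_ge0 ?nrm_ge0 ?divr_ge0 ?(ltW e0).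
  rewrite sqrrD; lra.
lra.
Qed.

Lemma projection_exists V x : lin_closed V -> adh_closed V ->
  exists2 p, V p & forall q, V q -> dotp (x - p) q = 0.
Proof.
move=> lV cV; have [p Vp pmin] := dist_minimizer x lV cV.
exists p => // q Vq; apply/eqP; rewrite -csq_eq0; set s := csq _.
have s0 : 0 <= s by exact: csq_ge0.
set Q := nrm q ^+ 2; have Q0 : 0 <= Q by exact: sqr_ge0.
(* Moving the minimiser along [q] would shorten the distance unless [s] vanishes. The denominator Q
   + 1, instead of the optimal Q, spares the case q = 0. *)
have := pmin (p + ((Q + 1)^-1%:C%C * dotp (x - p) q) *: q)
  (lin_closedD lV Vp (lin_closedZ _ lV Vq)).
rewrite -(ler_pXn2r (n := 2)) ?nnegrE ?nrm_ge0// opprD addrA -scaleNr.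
rewrite [x - p + _]addrC nrm2_expand csqN csqM csq_real -/s -/Q.
have -> : complex.Re ((- ((Q + 1)^-1%:C%C * dotp (x - p) q))^*%C * dotp (x - p) q) =
    - ((Q + 1)^-1 * s).
  by rewrite /s /csq; case: (dotp _ _) => a b /=; ring.
have Q1 : Q + 1 != 0 by lra.
have -> : nrm (x - p) ^+ 2 + - ((Q + 1)^-1 * s) *+ 2 + (Q + 1)^-1 ^+ 2 * s * Q =
   nrm (x - p) ^+ 2 - s * ((Q + 2) / (Q + 1) ^+ 2) by field.
move=> h; have {}h : s * ((Q + 2) / (Q + 1) ^+ 2) <= 0 by lra.
have c0 : 0 < (Q + 2) / (Q + 1) ^+ 2 by rewrite divr_gt0 ?exprn_gt0//; lra.
by move: h; rewrite pmulr_lle0// => sle; apply/eqP; lra.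
Qed.

Section orthproj.
Context V (lV : lin_closed V) (cV : adh_closed V).

Lemma orthprojP x : V (orthproj V x) /\
  forall q, V q -> dotp (x - orthproj V x) q = 0.
Proof.
rewrite /orthproj; case: xgetP => [p _ [Vp pP]//|].
by have [p Vp pP] := projection_exists x lV cV => /(_ p) /not_andP[].
Qed.

Lemma orthproj_mem x : V (orthproj V x). Proof. by have [] := orthprojP x. Qed.

Lemma orthproj_dot x q : V q -> dotp (orthproj V x) q = dotp x q.
Proof.
move=> Vq; have [_ /(_ q Vq)/eqP] := orthprojP x.
by rewrite dotpBl subr_eq0 => /eqP ->.
Qed.

Lemma orthproj_uniq x p : V p -> (forall q, V q -> dotp (x - p) q = 0) ->
  orthproj V x = p.
Proof.
move=> Vp pP; apply/eqP; rewrite -subr_eq0 -nrm_eq0 -sqrf_eq0.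
set d := orthproj V x - p.
have Vd : V d by apply: lin_closedB => //; exact: orthproj_mem.
apply/eqP/(@complexI R); rewrite -dotp_nrm rmorph0 /d dotpBl orthproj_dot//.
by rewrite -dotpBl pP.
Qed.

Lemma orthproj_id x : V x -> orthproj V x = x.
Proof. by move=> Vx; apply: orthproj_uniq => // q _; rewrite subrr dotp0l. Qed.

Lemma orthprojPZ a x y :
  orthproj V (a *: x + y) = a *: orthproj V x + orthproj V y.
Proof.
apply: orthproj_uniq => [|q Vq].
  by apply: lV.2; exact: orthproj_mem.
by rewrite dotpBl !dotpDl !dotpZl !orthproj_dot// subrr.
Qed.

Lemma nrm_orthproj x : nrm (orthproj V x) <= nrm x.
Proof.
rewrite -(ler_pXn2r (n := 2)) ?nnegrE ?nrm_ge0//.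
have -> : nrm x ^+ 2 = nrm ((x - orthproj V x) + orthproj V x) ^+ 2 by rewrite subrK.
rewrite nrm2D (orthprojP x).2; last exact: orthproj_mem.
by rewrite mul0rn addr0 lerDr sqr_ge0.
Qed.

End orthproj.
End projection.

Section orthonormal.
Context (R : realType) (H : innerProductType R).
Implicit Types (x y z : H) (V E : set H) (s : seq H).

(** Zorn: a maximal orthonormal subset of [V] is total, as a nonzero vector orthogonal to it could
    be normalised and added. *)
Lemma orthonormal_basis_exists V : lin_closed V ->
  exists E, orthonormal_basis V E.
Proof.
move=> lV.
pose P E := [/\ E `<=` V, forall x, E x -> nrm x = 1 &
  forall x y, E x -> E y -> x <> y -> dotp x y = 0].
have [F FP Ftot|E [[EV E1 E0] Emax]] := @Zorn_bigcup H P.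
  split.
  - by move=> x [A /FP[AV _ _] /AV].
  - by move=> x [A /FP[_ A1 _] /A1].
  - move=> x y [A FA Ax] [B FB By].
    have [AB|BA] := Ftot _ _ FA FB.
      by have [_ _] := FP _ FB; apply => //; exact: AB.
    by have [_ _] := FP _ FA; apply => //; exact: BA.
exists E; split => // x Vx xE; apply: contrapT => /eqP x0.
have nx : 0 < nrm x by rewrite lt_def nrm_ge0 nrm_eq0 x0.
pose y := (nrm x)^-1%:C%C *: x.
have y1 : nrm y = 1.
  apply/eqP; rewrite -(eqrXn2 (n := 2)) ?nrm_ge0//; apply/eqP.
  by rewrite nrm2Z csq_real -exprMn mulVf ?gt_eqF.
have yE e : E e -> dotp y e = 0 by move=> Ee; rewrite dotpZl xE// mulr0.
have EEy : E `<` E `|` [set y].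
  split => [z|/(_ y (or_intror erefl)) Ey]; first by left.
  have := dotp_nrm y; rewrite yE//; rewrite y1 expr1n => /eqP.
  by rewrite eq_complex /= eq_sym oner_eq0.
apply: (Emax _ EEy); split.
- by move=> z [/EV//|->]; exact: lin_closedZ.
- by move=> z [/E1//|->].
- move=> u v [Eu|->] [Ev|->] uv //; first exact: E0.
  + by rewrite dotpC yE// rmorph0.
  + exact: yE.
Qed.

Definition bproj s x : H := \sum_(e <- s) dotp x e *: e.

Lemma bprojPZ s a x y : bproj s (a *: x + y) = a *: bproj s x + bproj s y.
Proof.
rewrite /bproj scaler_sumr -big_split /=; apply: eq_bigr => e _.
by rewrite dotpDl dotpZl scalerDl scalerA.
Qed.

Section basis.
Context V E (lV : lin_closed V) (EP : orthonormal_basis V E).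

Let EV : E `<=` V. Proof. by case: EP. Qed.

Definition fin_in (s : seq H) := uniq s /\ forall e, e \in s -> E e.

Lemma bproj_mem s x : fin_in s -> V (bproj s x).
Proof.
move=> [_ sE]; rewrite /bproj big_seq; apply: lin_closed_sum => // e es.
by apply: lin_closedZ => //; apply: EV; exact: sE.
Qed.

Lemma dotp_comb s (c : H -> R[i]) e : fin_in s -> E e ->
  dotp (\sum_(f <- s) c f *: f) e = if e \in s then c e else 0.
Proof.
move=> [us sE] Ee; rewrite dotp_suml; have [_ E1 E0 _] := EP.
case: ifPn => es.
  rewrite (bigD1_seq e)//= dotpZl dotp_nrm E1// expr1n mulr1 big1_seq ?addr0//.
  move=> f /andP[/eqP fe fs]; rewrite dotpZl E0 ?mulr0//; exact: sE.
rewrite big1_seq// => f /= fs; rewrite dotpZl E0 ?mulr0//; first exact: sE.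
by move=> fe; move: es; rewrite -fe fs.
Qed.

Lemma nrm2_comb s (c : H -> R[i]) : fin_in s ->
  nrm (\sum_(f <- s) c f *: f) ^+ 2 = \sum_(f <- s) csq (c f).
Proof.
move=> fs; apply/(@complexI R); rewrite -dotp_nrm dotp_sumr rmorph_sum /=.
rewrite big_seq [RHS]big_seq; apply: eq_bigr => e es.
by rewrite dotpZr dotp_comb ?es -?csqE 1?mulrC//; exact: fs.2.
Qed.

Lemma nrm2_bprojB s x : fin_in s ->
  nrm (x - bproj s x) ^+ 2 = nrm x ^+ 2 - \sum_(e <- s) csq (dotp x e).
Proof.
move=> fs; rewrite addrC -scaleN1r nrm2_expand csqN csq1 mul1r.
rewrite nrm2_comb//.
have -> : dotp x (bproj s x) = (\sum_(e <- s) csq (dotp x e))%:C%C.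
  rewrite dotp_sumr rmorph_sum; apply: eq_bigr => e _.
  by rewrite dotpZr mulrC csqE.
rewrite /=; set A := \sum_(e <- s) _; ring.
Qed.

Lemma nrm_bprojB s x : fin_in s -> nrm (x - bproj s x) <= nrm x.
Proof.
move=> fs; rewrite -(ler_pXn2r (n := 2)) ?nnegrE ?nrm_ge0// nrm2_bprojB//.
by rewrite gerBl sumr_ge0// => e _; exact: csq_ge0.
Qed.

Lemma bproj_best s s' x : fin_in s -> fin_in s' -> {subset s <= s'} ->
  nrm (x - bproj s' x) <= nrm (x - bproj s x).
Proof.
move=> fs fs' ss; rewrite -(ler_pXn2r (n := 2)) ?nnegrE ?nrm_ge0// !nrm2_bprojB//.
rewrite lerD2l lerN2.
have -> : \sum_(e <- s) csq (dotp x e) = \sum_(e <- s' | e \in s) csq (dotp x e).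
  rewrite -[RHS]big_filter; apply: perm_big; apply: uniq_perm.
  - exact: fs.1.
  - by rewrite filter_uniq//; exact: fs'.1.
  - move=> e; rewrite mem_filter; apply/idP/andP => [es|[]//].
    by rewrite es; split => //; exact: ss.
by rewrite [leRHS](bigID (mem s))/= lerDl sumr_ge0// => e _; exact: csq_ge0.
Qed.

(** The vectors of [V] approximated by their own finite Fourier sums form a closed subspace W
    containing [E]. What remains of [x] after projection onto W is orthogonal to [E], hence 0 by
    totality. *)
Lemma basis_dense (H_complete : seq_complete H) (cV : adh_closed V) x (e : R) :
  V x -> 0 < e -> exists2 s, fin_in s & nrm (x - bproj s x) < e.
Proof.
move=> Vx.
pose W := [set y | V y /\
  forall e : R, 0 < e -> exists2 s, fin_in s & nrm (y - bproj s y) < e].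
have fcat s1 s2 : fin_in s1 -> fin_in s2 -> fin_in (undup (s1 ++ s2)).
  move=> [_ h1] [_ h2]; split; first exact: undup_uniq.
  by move=> y; rewrite mem_undup mem_cat => /orP[/h1|/h2].
have lW : lin_closed W.
  split=> [|a y z [Vy Wy] [Vz Wz]].
    split=> [|d d0]; first exact: lV.1.
    by exists [::] => //; rewrite /bproj big_nil subrr nrm0.
  split=> [|d d0]; first exact: lV.2.
  have a0 : 0 < nrm (a : R[i]^o) + 1 by rewrite ltr_wpDl// nrm_ge0.
  have [s1 f1 h1] := Wy (d / 2 / (nrm (a : R[i]^o) + 1)) ltac:(by rewrite !divr_gt0).
  have [s2 f2 h2] := Wz (d / 2) ltac:(by rewrite !divr_gt0).
  have fs := fcat _ _ f1 f2; exists (undup (s1 ++ s2)) => //.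
  rewrite bprojPZ opprD addrACA -scalerBr (le_lt_trans (nrmD _ _))//.
  set s := undup _; rewrite [ltRHS](splitr d) ltr_leD//; last first.
    apply/ltW/(le_lt_trans _ h2); apply: bproj_best => // f fs2.
    by rewrite mem_undup mem_cat fs2 orbT.
  have -> : nrm (a *: (y - bproj s y)) = nrm (a : R[i]^o) * nrm (y - bproj s y).
    by apply/(@complexI R); rewrite rmorphM /= -!nrmE normrZ.
  rewrite (@le_lt_trans _ _ ((nrm (a : R[i]^o) + 1) * nrm (y - bproj s y)))//.
    by rewrite ler_wpM2r ?nrm_ge0// lerDl.
  rewrite mulrC -ltr_pdivlMr//; apply: le_lt_trans h1; apply: bproj_best => // f fs1.
  by rewrite mem_undup mem_cat fs1.
have cW : adh_closed W.
  move=> y yW; have Vy : V y.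
    by apply: cV => d /yW[v [Vv _] yv]; exists v.
  split => // d d0; have [v [Vv Wv] yv] := yW (d / 2) ltac:(by rewrite divr_gt0).
  have [s fs h] := Wv (d / 2) ltac:(by rewrite divr_gt0).
  exists s => //; have -> : y - bproj s y = (v - bproj s v) + ((y - v) - bproj s (y - v)).
    have -> : bproj s (y - v) = bproj s y - bproj s v.
      by rewrite addrC -scaleN1r bprojPZ scaleN1r addrC.
    by rewrite opprB addrACA [v + _]addrC subrK addKr.
  rewrite (le_lt_trans (nrmD _ _))// [ltRHS]splitr ltrD//.
  exact: le_lt_trans (nrm_bprojB _ fs) yv.
have [p [Vp Wp] pP] := projection_exists H_complete x lW cW.
suff -> : x = p by exact: Wp.
apply/eqP; rewrite -subr_eq0; apply/eqP; have [_ E1 E0 Etot] := EP.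
apply: Etot; first exact: lin_closedB.
move=> f Ef; apply: pP; split=> [|d d0]; first exact: EV.
exists [:: f]; first by split=> // g; rewrite inE => /eqP ->.
by rewrite /bproj big_seq1 dotp_nrm (E1 f)// expr1n scale1r subrr nrm0.
Qed.

End basis.
End orthonormal.

(** * Norm of a bounded functional from its values on an orthonormal basis *)

Section linear_functional.
Context (R : realType) (H : innerProductType R) (H_complete : seq_complete H).
Context (V E : set H) (lV : lin_closed V) (cV : adh_closed V).
Hypothesis EP : orthonormal_basis V E.

Lemma nrmZl (K : normedModType R[i]) (a : R[i]) (x : K) :
  nrm (a *: x) = nrm (a : R[i]^o) * nrm x.
Proof. by apply/(@complexI R); rewrite rmorphM /= -!nrmE normrZ. Qed.

Lemma additive_on_comb (phi : H -> R[i]) (I : eqType) (s : seq I)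
    (c : I -> R[i]) (f : I -> H) :
  (forall a x y, V x -> V y -> phi (a *: x + y) = a * phi x + phi y) ->
  (forall i, i \in s -> V (f i)) ->
  phi (\sum_(i <- s) c i *: f i) = \sum_(i <- s) c i * phi (f i).
Proof.
move=> phiL fV; have phi0 : phi 0 = 0.
  have := phiL 1 0 0 lV.1 lV.1; rewrite scaler0 addr0 mul1r => /eqP.
  by rewrite -subr_eq0 opprD addrA subrr sub0r oppr_eq0 => /eqP.
elim: s fV => [|i s IH] fV; first by rewrite !big_nil.
have fVs j : j \in s -> V (f j) by move=> js; apply: fV; rewrite inE js orbT.
rewrite !big_cons phiL ?IH//; first by apply: fV; rewrite mem_head.
by rewrite big_seq; apply: lin_closed_sum => // j /fVs; exact: lin_closedZ.
Qed.

Section functional.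
Context (phi : H -> R[i]) (M t : R).
Hypothesis phiL : forall a x y, V x -> V y -> phi (a *: x + y) = a * phi x + phi y.
Hypothesis phiM : forall x, V x -> csq (phi x) <= M * nrm x ^+ 2.
Hypothesis phit : forall s, fin_in E s -> \sum_(e <- s) csq (phi e) <= t.

(** The a priori bound [M] only serves to neglect the remainder of a finite Fourier sum of [x]; on
    the sum itself Cauchy-Schwarz gives the constant [t]. *)
Lemma functional_parseval x : V x -> csq (phi x) <= t * nrm x ^+ 2.
Proof.
move=> Vx; have t0 : 0 <= t by have := phit (s := [::]); rewrite big_nil; apply.
have sqle (u v : R) : 0 <= u -> 0 <= v -> u ^+ 2 <= v ^+ 2 -> u <= v.
  by move=> u0 v0; rewrite ler_pXn2r.
suff h : nrm (phi x : R[i]^o) <= Num.sqrt t * nrm x.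
  rewrite -nrm_csq -(sqr_sqrtr t0) -exprMn ler_pXn2r// nnegrE ?nrm_ge0//.
  by rewrite mulr_ge0 ?sqrtr_ge0 ?nrm_ge0.
apply/ler_addgt0Pr => e e0.
pose M' := `|M| + 1; have M0 : 0 < M' by rewrite ltr_wpDl.
have sM0 : 0 < Num.sqrt M' by rewrite sqrtr_gt0.
have [s fs xs] := basis_dense lV EP H_complete cV Vx (divr_gt0 e0 sM0).
have Vs : V (bproj s x) by exact: (bproj_mem lV EP).
have -> : phi x = phi (bproj s x) + phi (x - bproj s x).
  rewrite -{1}[x](subrK (bproj s x)) -[x - _]scale1r phiL//; last exact: lin_closedB.
  by rewrite scale1r mul1r addrC.
apply: (le_trans (nrmD (phi (bproj s x) : R[i]^o) _)); apply: lerD.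
  apply: sqle; rewrite ?nrm_ge0 ?mulr_ge0 ?sqrtr_ge0 ?nrm_ge0//.
  rewrite nrm_csq exprMn sqr_sqrtr//.
  (* On the span of [s], [phi] is represented by the vector with coefficients the conjugates of
     [phi f], whose squared norm is at most [t]. *)
  have -> : phi (bproj s x) = dotp x (\sum_(f <- s) ((phi f)^*)%C *: f).
    rewrite /bproj additive_on_comb// => [|f /fs.2]; last by case: EP => + _ _ _; exact.
    by rewrite dotp_sumr; apply: eq_bigr => f _; rewrite dotpZr conjcK mulrC.
  apply: le_trans (dotp_CS _ _) _; rewrite mulrC ler_wpM2r ?sqr_ge0//.
  rewrite (nrm2_comb EP)//; under eq_bigr do rewrite csqJ.
  exact: phit.
apply: sqle; rewrite ?nrm_ge0 ?(ltW e0)//.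
rewrite nrm_csq; apply: le_trans (phiM (lin_closedB lV Vx Vs)) _.
apply: (@le_trans _ _ (M' * (e / Num.sqrt M') ^+ 2)).
  apply: (@le_trans _ _ (M' * nrm (x - bproj s x) ^+ 2)).
    rewrite ler_wpM2r ?sqr_ge0// /M'; have := ler_norm M; lra.
  by rewrite ler_pM2l// ler_pXn2r ?nnegrE ?nrm_ge0 ?divr_ge0 ?(ltW e0) ?(ltW sM0)// ltW.
by rewrite exprMn exprVn sqr_sqrtr ?(ltW M0)// mulrCA divff ?mulr1// gt_eqF.
Qed.

End functional.
End linear_functional.

(** * Traces of forms over Bessel families *)

(** The Bessel condition in its synthesis form: the map sending [c] to the combination of the first
    [N] vectors has squared norm at most [B]. It is dual to bounding the sum of the |<x, beta_j>|^2
    by B |x|^2. *)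
Definition bessel_family (R : realType) (H : innerProductType R)
    (beta : nat -> H) (N : nat) (B : R) :=
  forall c : nat -> R[i],
    nrm (\sum_(j < N) c j *: beta j) ^+ 2 <= B * \sum_(j < N) csq (c j).

Section form_trace.
Context (R : realType) (H : innerProductType R) (H_complete : seq_complete H).
Context (V E : set H) (lV : lin_closed V) (cV : adh_closed V).
Hypothesis EP : orthonormal_basis V E.

(** Duality: let x be the combination of the beta_j with the conjugates of phi(beta_j) as
    coefficients. Then phi x is the sum S itself, and S^2 <= t |x|^2 <= t B S. *)
Lemma functional_bessel (phi : H -> R[i]) (M t : R) (beta : nat -> H) N (B : R) :
  (forall a x y, V x -> V y -> phi (a *: x + y) = a * phi x + phi y) ->
  (forall x, V x -> csq (phi x) <= M * nrm x ^+ 2) ->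
  (forall s, fin_in E s -> \sum_(e <- s) csq (phi e) <= t) ->
  0 <= B -> (forall j, V (beta j)) -> bessel_family beta N B ->
  \sum_(j < N) csq (phi (beta j)) <= B * t.
Proof.
move=> phiL phiM phit B0 Vb bB; set S := \sum_(j < N) _.
have t0 : 0 <= t by have := phit [::]; rewrite big_nil; apply.
have S0 : 0 <= S by rewrite sumr_ge0// => j _; exact: csq_ge0.
pose c j := ((phi (beta j))^*)%C.
pose x := \sum_(j < N) c j *: beta j.
have Vx : V x by apply: lin_closed_sum => // j _; exact: lin_closedZ.
have phix : phi x = S%:C%C.
  rewrite /x (additive_on_comb lV _ phiL)// rmorph_sum; apply: eq_bigr => j _.
  by rewrite mulrC csqE.
have xS : nrm x ^+ 2 <= B * S.
  by apply: le_trans (bB c) _; rewrite /c; under eq_bigr do rewrite csqJ.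
have := functional_parseval H_complete lV cV EP phiL phiM phit Vx.
rewrite phix csq_real => h.
have {}h : S ^+ 2 <= B * t * S.
  by rewrite (le_trans h)// [B * t]mulrC -mulrA ler_wpM2l.
have [->|Sn] := eqVneq S 0; first by rewrite mulr_ge0.
by move: h; rewrite expr2 ler_pM2r// lt_def Sn.
Qed.

Lemma esum_fin_in (f : H -> \bar R) s : (forall x, E x -> (0 <= f x)%E) -> fin_in E s ->
  (\sum_(e <- s) f e <= \esum_(e in E) f e)%E.
Proof.
move=> f0 [us sE]; rewrite fsbig_seq//; apply: esum_ge; exists [set` s] => //.
by split=> [|e es]; [exact: finite_seq|exact: sE].
Qed.

(* Induction on N: the vector b = beta_N is split off by the functional
   [phi x = q x b], since [q x y - phi x * (phi y)^* / q b b] is again positive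
   semidefinite and vanishes at b. *)
Lemma form_trace_bessel (q : H -> H -> R[i]) (t : R) (beta : nat -> H) N (B : R) :
  psd_form V q ->
  (\esum_(e in E) (complex.Re (q e e))%:E <= t%:E)%E ->
  0 <= B -> (forall j, V (beta j)) -> bessel_family beta N B ->
  \sum_(j < N) complex.Re (q (beta j) (beta j)) <= B * t.
Proof.
move=> + + B0 Vb; elim: N q t => [|N IH] q t qP qt bB.
  rewrite big_ord0 mulr_ge0// -lee_fin (le_trans _ qt)// esum_ge0// => e Ee.
  by rewrite lee_fin (form_ge0 qP)//; case: EP => + _ _ _; exact.
have EV : E `<=` V by case: EP.
have bBN : bessel_family beta N B.
  move=> c; have := bB (fun j => if (j < N)%N then c j else 0).
  rewrite !big_ord_recr /= ltnn scale0r csq0 !addr0.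
  by under eq_bigr do rewrite ltn_ord; under [X in _ <= _ * X]eq_bigr do rewrite ltn_ord.
set b := beta N; have Vb' : V b by exact: Vb.
set d := complex.Re (q b b); have d0 : 0 <= d by exact: (form_ge0 qP).
have [dz|dn] := eqVneq d 0.
  by rewrite big_ord_recr /= -/b -/d dz addr0; exact: IH.
have {dn}d0 : 0 < d by rewrite lt_def dn.
pose phi x := q x b.
pose q' x y := q x y - d^-1%:C%C * (q x b * ((q y b)^*)%C).
have q'Re x : complex.Re (q' x x) = complex.Re (q x x) - d^-1 * csq (phi x).
  by rewrite /q' csqE -rmorphM /= -/(phi x); case: (q x x).
have phiL a x y : V x -> V y -> phi (a *: x + y) = a * phi x + phi y.
  by move=> Vx Vy; rewrite /phi (form_lin qP).
have CS x : V x -> csq (phi x) <= complex.Re (q x x) * d.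
  by move=> Vx; exact: (form_CS lV qP Vx Vb').
have q'0 x : V x -> 0 <= complex.Re (q' x x).
  by move=> Vx; rewrite q'Re subr_ge0 mulrC ler_pdivrMr// CS.
have [M MP] := form_bounded qP.
have q'P : psd_form V q'.
  split => //.
  - move=> a x y z Vx Vy Vz; rewrite /q' !(form_lin qP)//; ring.
  - move=> x y Vx Vy; rewrite /q' (form_herm qP Vx Vy) rmorphB !rmorphM /= conjcK.
    by rewrite oppr0 [_^*%C * _]mulrC.
  - exists M => x Vx; rewrite q'Re (le_trans _ (MP x Vx))// gerBl mulr_ge0 ?csq_ge0//.
    by rewrite invr_ge0 ltW.
have dphi x : complex.Re (q x x) = complex.Re (q' x x) + d^-1 * csq (phi x).
  by rewrite q'Re subrK.
have dphi0 x : 0 <= d^-1 * csq (phi x) by rewrite mulr_ge0 ?csq_ge0// invr_ge0 ltW.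
have q'E0 e : E e -> (0 <= (complex.Re (q' e e))%:E)%E.
  by move=> /EV Ve; rewrite lee_fin q'0.
have phiE0 e : E e -> (0 <= (d^-1 * csq (phi e))%:E)%E by rewrite lee_fin.
(* The trace over [E] splits into [t1], the part of q', and [t2], the part of the rank one form; the
   induction hypothesis uses [t1], [functional_bessel] uses [t2]. *)
move: qt; under eq_esum do rewrite dphi EFinD; rewrite esumD//.
set t1 := esum _ _; set t2 := esum _ _.
have t10 : (0 <= t1)%E by exact: esum_ge0.
have t20 : (0 <= t2)%E by exact: esum_ge0.
move=> t12.
have t1f : t1 \is a fin_num.
  by rewrite ge0_fin_numE// (le_lt_trans _ (ltry t))// (le_trans _ t12)// leeDl.
have t2f : t2 \is a fin_num.
  by rewrite ge0_fin_numE// (le_lt_trans _ (ltry t))// (le_trans _ t12)// leeDr.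
have h1 : \sum_(j < N) complex.Re (q' (beta j) (beta j)) <= B * fine t1.
  by apply: IH => //; rewrite fineK.
have h2 : \sum_(j < N.+1) csq (phi (beta j)) <= B * (d * fine t2).
  apply: (@functional_bessel phi (M * d)) => //.
  - by move=> x Vx; rewrite (le_trans (CS _ Vx))// mulrAC ler_pM2r// MP.
  - move=> s fs; rewrite -ler_pdivrMl// mulr_sumr -lee_fin fineK// -sumEFin.
    exact: esum_fin_in.
under eq_bigr do rewrite dphi; rewrite big_split /= -mulr_sumr.
rewrite big_ord_recr /= -/b.
(* Hence the last vector counts in the rank one part only, and the induction hypothesis for [N]
   vectors suffices. *)
have -> : complex.Re (q' b b) = 0.
  rewrite q'Re /phi (form_real qP Vb') csq_real -/d expr2 mulrA mulVf ?gt_eqF//.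
  by rewrite mul1r /d {1}(form_real qP Vb') subrr.
rewrite addr0; move: t12; rewrite -(fineK t1f) -(fineK t2f) -EFinD lee_fin => t12.
apply: (@le_trans _ _ (B * fine t1 + B * fine t2)).
  apply: (lerD h1); rewrite mulrC ler_pdivrMr//.
  by apply: le_trans h2 _; rewrite [d * _]mulrC mulrA.
by rewrite -mulrDr ler_wpM2l.
Qed.

End form_trace.

(** * Orthonormal sequences and traces on a subspace *)

Section orthonormal_sequence.
Context (R : realType) (H : innerProductType R) (H_complete : seq_complete H).

(* Zero vectors are allowed, so that finite dimension needs no special case. *)
Definition basis_seq (a : nat -> H) :=
  [/\ forall i j, i <> j -> dotp (a i) (a j) = 0,
      forall i, nrm (a i) = 1 \/ a i = 0 &
      forall x, (forall n, dotp x (a n) = 0) -> x = 0].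

(** A vector that depends on its predecessors has residue 0 and contributes a zero entry. *)
Let gs_step (s : seq H) (x : H) :=
  let r := x - \sum_(e <- s) dotp x e *: e in (nrm r)^-1%:C%C *: r.

(** Gram-Schmidt applied to a total sequence, which may be linearly dependent. *)
Lemma basis_seq_exists (d : nat -> H) :
  (forall x, (forall n, dotp x (d n) = 0) -> x = 0) -> exists a, basis_seq a.
Proof.
move=> dtot.
pose L := fix L n := if n is m.+1 then rcons (L m) (gs_step (L m) (d m)) else [::].
pose a n := gs_step (L n) (d n).
have LE n : L n = [seq a i | i <- iota 0 n].
  by elim: n => // n IH; rewrite -addn1 iotaD map_cat -IH cats1 addn1.
have a01 n : nrm (a n) = 1 \/ a n = 0.
  rewrite /a /gs_step; set r := d n - _; have [->|r0] := eqVneq r 0.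
    by right; rewrite scaler0.
  left; have nr : nrm r != 0 by rewrite nrm_eq0.
  apply/eqP; rewrite -(eqrXn2 (n := 2)) ?nrm_ge0//; apply/eqP.
  by rewrite nrm2Z csq_real -exprMn mulVf.
have sumL n (f : H -> H) : \sum_(e <- L n) f e = \sum_(i < n) f (a i).
  by rewrite LE big_map -{1}(subn0 n) -/(index_iota 0 n) big_mkord.
have aa i j : (i < j)%N -> dotp (a j) (a i) = 0.
  elim/ltn_ind : j i => j IH i ij.
  have [ai|->] := a01 i; last by rewrite dotp0r.
  rewrite {1}/a /gs_step dotpZl dotpBl sumL.
  rewrite dotp_suml [X in _ * (_ - X)](bigD1 (Ordinal ij))//=.
  rewrite [X in _ * (_ - (_ + X))]big1 ?addr0 => [|k /= ki].
    by rewrite dotpZl [dotp (a i) (a i)]dotp_nrm ai expr1n mulr1 subrr mulr0.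
  have {}ki : (k != i :> nat) by apply: contra_neq ki => ki; exact: val_inj.
  rewrite dotpZl; have [ik|ik|/eqP] := ltngtP k i; last by rewrite (negbTE ki).
    by rewrite [dotp (a k) _]dotpC (IH i)// rmorph0 mulr0.
  by rewrite (IH k)// mulr0.
exists a; split => //.
  move=> i j ij; have [/aa h|/aa//|//] := ltngtP i j.
  by rewrite dotpC h rmorph0.
move=> x xa; apply: dtot => n.
set r := d n - \sum_(e <- L n) dotp (d n) e *: e.
(* Each [d n] is recovered from the entries of [a] up to n, so that totality passes from [d] to
   [a]. *)
have -> : d n = (nrm r)%:C%C *: a n + \sum_(i < n) dotp (d n) (a i) *: a i.
  rewrite -(sumL n (fun e => dotp (d n) e *: e)) /a /gs_step -/r scalerA -rmorphM /=.
  have [r0|r0] := eqVneq r 0.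
    by rewrite r0 scaler0 add0r; apply/eqP; rewrite -subr_eq0 -/r r0.
  by rewrite divff ?nrm_eq0// scale1r subrK.
rewrite dotpDr dotpZr xa mulr0 add0r dotp_sumr big1// => i _.
by rewrite dotpZr xa mulr0.
Qed.

Context (a : nat -> H) (aP : basis_seq a).

Let E := [set a n | n in [set n | a n != 0]].

Lemma basis_seq_inj i j : a i != 0 -> a i = a j -> i = j.
Proof.
move=> ai aij; apply: contrapT => ij; have [a0 a1 _] := aP.
have := a0 _ _ ij; rewrite -aij dotp_nrm; have [->|ai0] := a1 i.
  by rewrite expr1n => /eqP; rewrite eq_complex /= oner_eq0.
by rewrite ai0 eqxx in ai.
Qed.

Lemma basis_seq_range : orthonormal_basis [set: H] E.
Proof.
have [a0 a1 at_] := aP; split => //.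
- by move=> _ [n /= an <-]; have [//|an0] := a1 n; rewrite an0 eqxx in an.
- by move=> _ _ [m /= am <-] [n /= an <-] mn; apply: a0 => mn'; apply: mn; rewrite mn'.
- move=> x _ xE; apply: at_ => n; have [->|an] := eqVneq (a n) 0.
    by rewrite dotp0r.
  by apply: xE; exists n.
Qed.

(** A good finite list from [basis_dense] lies among the first [N] entries, and by [bproj_best] a
    longer orthonormal list approximates at least as well. Zero entries are filtered out, since they
    add nothing to the sum. *)
Lemma basis_seq_expansion x (e : R) : 0 < e -> exists N, forall M, (N <= M)%N ->
  nrm (x - \sum_(m < M) dotp x (a m) *: a m) < e.
Proof.
move=> e0; have EP := basis_seq_range.
have [s fs xs] := basis_dense (@lin_closedT R H) EP H_complete
  (fun _ _ => I) (I : [set: H] x) e0.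
have [N NP] : exists N, forall f, f \in s -> exists2 m, (m < N)%N & f = a m.
  have [_] := fs; elim: s {fs xs} => [|f s IH] fs; first by exists 0.
  have [|N NP] := IH; first by move=> g gs; apply: fs; rewrite inE gs orbT.
  have [m _ fm] := fs f (mem_head _ _); exists (maxn N m.+1) => g.
  rewrite inE => /orP[/eqP ->|/NP[k kN ->]]; first by exists m; rewrite // leq_maxr.
  by exists k => //; rewrite (leq_trans kN)// leq_maxl.
exists N => M NM.
pose s' := [seq a m | m <- iota 0 M & a m != 0].
have fs' : fin_in E s'.
  split=> [|f /mapP[m]]; last by rewrite mem_filter => /andP[am _] ->; exists m.
  rewrite map_inj_in_uniq ?filter_uniq ?iota_uniq// => i j.
  by rewrite mem_filter => /andP[ai _] _; exact: basis_seq_inj.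
have -> : \sum_(m < M) dotp x (a m) *: a m = bproj s' x.
  rewrite /bproj big_map big_filter -[in RHS](subn0 M) -/(index_iota 0 M) big_mkord.
  rewrite [LHS](bigID (fun m : 'I_M => a m != 0))/= [X in _ + X]big1 ?addr0// => m.
  by rewrite negbK => /eqP ->; rewrite scaler0.
apply: le_lt_trans xs; apply: (bproj_best EP) => // f fs0.
have [m mN fm] := NP f fs0; apply/mapP; exists m => //.
rewrite mem_filter mem_iota /= add0n (leq_trans mN NM) andbT -fm.
by have [n /= an <-] := fs.2 _ fs0.
Qed.

Lemma basis_seq_comb_bessel N : bessel_family a N 1.
Proof.
move=> c; rewrite mul1r; have [a0 a1 _] := aP.
elim: N => [|N IH]; first by rewrite !big_ord0 nrm0 expr0n.
rewrite !big_ord_recr /= nrm2D.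
have -> : dotp (\sum_(j < N) c j *: a j) (c N *: a N) = 0.
  rewrite dotp_suml big1// => j _; rewrite dotpZl dotpZr a0 ?mulr0//.
  by move=> jN; have := ltn_ord j; rewrite jN ltnn.
rewrite mul0rn addr0 lerD// nrm2Z; have [->|->] := a1 N.
  by rewrite expr1n mulr1.
by rewrite nrm0 expr0n /= mulr0 csq_ge0.
Qed.

(** Only an inequality: indices with a zero entry are absent on the left and contribute [f 0] on the
    right. *)
Lemma esum_basis_seq (f : H -> \bar R) : (forall x, (0 <= f x)%E) ->
  (\esum_(e in E) f e <= \sum_(n <oo) f (a n))%E.
Proof.
move=> f0; rewrite (@reindex_esum _ _ _ [set n | a n != 0] E a)//.
  rewrite nneseries_esumT// esum_mkcond; apply: le_esum => n _.
  by case: ifP.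
split=> [n|i j|x]; [by move=> an; exists n| |exact].
by rewrite !inE => ai _; exact: basis_seq_inj.
Qed.

Lemma closed_subspace_adh (V : set H) : closed_subspace V -> lin_closed V /\ adh_closed V.
Proof. by move=> [V0 lV cV]; split; [split|exact: closed_adh]. Qed.

(** [Q] is extended to the whole space by precomposing with the projection onto [J]. The hypothesis
    bounds the trace of the extension over the basis [a], and any finite part of an orthonormal
    basis of [J] is a Bessel family with bound 1, so its partial trace is bounded by that same
    number. *)
Lemma form_trace_restrict (J : set H) (Q : H -> H -> R[i]) :
  lin_closed J -> adh_closed J -> psd_form J Q ->
  (\sum_(n <oo) (complex.Re (Q (orthproj J (a n)) (orthproj J (a n))))%:E < +oo)%E ->
  exists2 F, orthonormal_basis J F & (\esum_(e in F) (complex.Re (Q e e))%:E < +oo)%E.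
Proof.
move=> lJ cJ QP Qoo; have [F FP] := orthonormal_basis_exists lJ.
have FJ : F `<=` J by case: FP.
exists F => //.
have Pm x : J (orthproj J x) by exact: orthproj_mem.
pose q x y := Q (orthproj J x) (orthproj J y).
have qP : psd_form [set: H] q.
  split.
  - by move=> c x y z _ _ _; rewrite /q orthprojPZ// (form_lin QP).
  - by move=> x y _ _; rewrite /q (form_herm QP).
  - by move=> x _; exact: (form_ge0 QP).
  - have [M MP] := form_bounded QP; exists `|M| => x _.
    apply: le_trans (MP _ (Pm x)) _.
    apply: (@le_trans _ _ (`|M| * nrm (orthproj J x) ^+ 2)).
      by rewrite ler_wpM2r ?sqr_ge0// ler_norm.
    by rewrite ler_wpM2l// ler_pXn2r ?nnegrE ?nrm_ge0// nrm_orthproj.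
have s0 : (0 <= \sum_(n <oo) (complex.Re (q (a n) (a n)))%:E)%E.
  by apply: nneseries_ge0 => n _ _; rewrite lee_fin (form_ge0 QP).
have sf : (\sum_(n <oo) (complex.Re (q (a n) (a n)))%:E)%E \is a fin_num.
  by rewrite ge0_fin_numE.
apply: le_lt_trans (ltry (fine (\sum_(n <oo) (complex.Re (q (a n) (a n)))%:E)%E)).
apply: ge_ereal_sup => _ [X [fX XF] <-].
have /finite_seqP[s0' Xs0] := fX.
pose s := undup s0'; have Xs : X = [set` s].
  by rewrite Xs0; apply/seteqP; split => x /=; rewrite mem_undup.
have fs : fin_in F s by split=> [|e es]; [exact: undup_uniq|apply: XF; rewrite Xs].
rewrite Xs -fsbig_seq ?undup_uniq// sumEFin lee_fin.
have -> : \sum_(e <- s) complex.Re (Q e e) =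
    \sum_(j < size s) complex.Re (q (nth 0 s j) (nth 0 s j)).
  rewrite (big_nth 0) big_mkord; apply: eq_bigr => j _.
  have Jj : J (nth 0 s j) by apply: FJ; apply: fs.2; exact: mem_nth.
  by rewrite /q orthproj_id.
rewrite -[leRHS]mul1r.
apply: (@form_trace_bessel _ _ H_complete [set: H] E (@lin_closedT R H) (fun _ _ => I)
  basis_seq_range q _ (nth 0 s)) => //.
  rewrite fineK//; apply: (esum_basis_seq (f := fun x => (complex.Re (q x x))%:E)) => x.
  by rewrite lee_fin (form_ge0 QP).
move=> c; rewrite mul1r.
(* Coefficients indexed by positions become a function of the vector through [index], which is
   faithful as [s] has no repetition. *)
have -> : \sum_(j < size s) c j *: nth 0 s j = \sum_(e <- s) c (index e s) *: e.
  by rewrite (big_nth 0) big_mkord; apply: eq_bigr => j _; rewrite index_uniq ?undup_uniq.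
rewrite (nrm2_comb FP)// (big_nth 0) big_mkord le_eqVlt; apply/orP; left; apply/eqP.
by apply: eq_bigr => j _; rewrite index_uniq ?undup_uniq.
Qed.

End orthonormal_sequence.

(** * Strong measurability *)

Section rounding.
Variable R : realType.
Implicit Types (x : R) (n : nat).

(** Truncation to [-n, n] followed by rounding down to a multiple of 1/(n+1): the range is finite,
    the map is monotone, hence Borel, and the error is small once the truncation is inactive. *)
Definition round n x : R :=
  (Num.floor (Num.max (- n%:R) (Num.min x n%:R) * n.+1%:R))%:~R / n.+1%:R.

Lemma round_homo n : {homo round n : x y / x <= y}.
Proof.
move=> x y xy; rewrite /round ler_pM2r ?invr_gt0// ler_int.
apply: le_floor; rewrite ler_pM2r//.
have mm : Num.min x n%:R <= Num.min y n%:R by rewrite le_min !ge_min xy lexx orbT.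
by rewrite ge_max !le_max lexx mm orbT.
Qed.

Lemma round_error n x : `|x| <= n%:R -> `|x - round n x| <= n.+1%:R^-1.
Proof.
move=> xn; have /andP[nx xn'] : - n%:R <= x <= n%:R by rewrite -ler_norml.
rewrite /round (min_idPl xn') (max_idPr nx).
set m := Num.floor _; have := floor_itv (x * n.+1%:R : R).
rewrite -/m => /andP[mx xm].
have n0 : 0 < n.+1%:R :> R by [].
rewrite ger0_norm; last by rewrite subr_ge0 ler_pdivrMr.
rewrite -(ler_pM2r n0) mulrBl divfK ?gt_eqF// mulVf ?gt_eqF//.
by move: xm; rewrite intrD; move: (m%:~R) => r; lra.
Qed.

Lemma round_finite n : finite_set (range (round n)).
Proof.
apply: (@sub_finite_set _ _ [set ((k%:R - (n * n.+1)%:R) / n.+1%:R : R) |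
    k in `I_((n * n.+1) + (n * n.+1)).+1]); last first.
  exact/finite_image/finite_II.
move=> _ [x _ <-]; rewrite /round; set y := Num.max _ _.
have /andP[ny yn] : - n%:R <= y <= n%:R.
  have nn : - n%:R <= n%:R :> R by rewrite (@le_trans _ _ 0) ?oppr_le0.
  by rewrite /y le_max lexx ge_max ge_min lexx nn orbT.
have n0 : 0 < n.+1%:R :> R by [].
set m := Num.floor _.
have m1 : - (n * n.+1)%:Z <= m.
  rewrite floor_ge_int rmorphN /= -pmulrn natrM -mulNr ler_pM2r//.
have m2 : m <= (n * n.+1)%:Z.
  by rewrite -(ler_int R) (le_trans (floor_le _))// -pmulrn natrM ler_pM2r.
exists (absz (m + (n * n.+1)%:Z)).
  by rewrite /= ltnS -lez_nat gez0_abs ?PoszD ?lerD2r// addrC -lerBlDl sub0r.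
rewrite pmulrn gez0_abs; last by rewrite -lerBlDr sub0r.
by rewrite intrD -pmulrn addrK.
Qed.

End rounding.

Section strong_measurability.
Context d (T : measurableType d) (R : realType).

Lemma simple_round n (f : T -> R) : measurable_fun setT f ->
  simple_map (fun x => round n (f x)).
Proof.
move=> mf; split.
  apply: sub_finite_set (round_finite R n) => _ [x _ <-]; by exists (f x).
move=> a; rewrite -[X in measurable X]setTI.
have mr : measurable_fun [set: R] (round n).
  by apply: nondecreasing_measurable => // x y *; exact: round_homo.
exact: (measurableT_comp mr mf).
Qed.

Definition cround n (z : R[i]) : R[i] := (round n (complex.Re z) +i* round n (complex.Im z))%C.

Lemma simple_cround n (f : T -> R[i]) : complex_measurable f ->
  simple_map (fun x => cround n (f x)).
Proof.
move=> [mr mi]; apply: (@simple_map_comp _ _ _ _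
  (fun x => (round n (complex.Re (f x)), round n (complex.Im (f x)))) (fun p => (p.1 +i* p.2)%C)).
by apply: simple_map_pair; exact: simple_round.
Qed.

Lemma cround_error n (z : R[i]) : `|complex.Re z| <= n%:R -> `|complex.Im z| <= n%:R ->
  nrm (z - cround n z : R[i]^o) <= n.+1%:R^-1 *+ 2.
Proof.
move=> /round_error h1 /round_error h2.
rewrite -(ler_pXn2r (n := 2)) ?nnegrE ?nrm_ge0 ?mulrn_wge0 ?invr_ge0//.
rewrite nrm_csq /csq; case: z h1 h2 => a b /=.
rewrite !ler_norml; move: (n.+1%:R^-1) => r /andP[a1 a2] /andP[b1 b2].
by rewrite -mulr_natl exprMn; nra.
Qed.

Lemma cvg_nrmP (H : normedModType R[i]) (u : nat -> H) (l : H) :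
  (forall e : R, 0 < e -> exists N, forall n, (N <= n)%N -> nrm (l - u n) < e) ->
  u n @[n --> \oo] --> l.
Proof.
move=> ul; apply/cvgrPdist_lt => e e0.
have [er ei] : 0 < complex.Re e /\ complex.Im e = 0.
  by move: e0; case: (e) => a b; rewrite ltcE /= => /andP[/eqP -> ->].
have [N NP] := ul _ er; exists N => // n /= Nn.
rewrite nrmE; have := NP n Nn; move: er ei; case: (e) => a b /= xv -> h.
by rewrite ltcR.
Qed.

Lemma strongly_measurable_complex (f : T -> R[i]) : complex_measurable f ->
  strongly_measurable (f : T -> R[i]^o).
Proof.
move=> mf; exists (fun n x => cround n (f x)); split=> [n|x]; first exact: simple_cround.
apply: cvg_nrmP => e e0.
have [N NP] := eventually_inv_lt (divr_gt0 e0 (ltr0n R 2)).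
pose b := Num.max `|complex.Re (f x)| `|complex.Im (f x)|.
exists (maxn N (Num.truncn b).+1) => n; rewrite geq_max => /andP[Nn bn].
have bn' : b <= n%:R.
  by rewrite (le_trans (ltW (truncnS_gt b)))// ler_nat.
apply: le_lt_trans (cround_error _ _) _; rewrite ?(le_trans _ bn') ?le_max ?lexx ?orbT//.
by have := NP n Nn; move: (n.+1%:R^-1) => r; lra.
Qed.

Lemma complex_measurable_dotp (H : innerProductType R) (f g : T -> H) :
  strongly_measurable f -> strongly_measurable g ->
  complex_measurable (fun x => dotp (f x) (g x)).
Proof.
by move=> mf mg; split; [exact: measurable_Re_dotp|exact: measurable_Im_dotp].
Qed.

Lemma complex_measurable_sm (f : T -> R[i]^o) : strongly_measurable f ->
  complex_measurable (f : T -> R[i]).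
Proof.
move=> mf; have := complex_measurable_dotp mf (strongly_measurable_cst T (1 : R[i]^o)).
rewrite /dotp /= (_ : (fun x => f x * (1^*)%C) = f)//.
by apply/funext => x; rewrite rmorph1 mulr1.
Qed.

(* A special case of Pettis' measurability theorem. *)
Lemma strongly_measurable_basis (H : innerProductType R) (H_complete : seq_complete H)
    (a : nat -> H) (aP : basis_seq a) (f : T -> H) (b : nat) :
  (forall n, complex_measurable (fun x => dotp (f x) (a n))) ->
  (forall x, nrm (f x) <= b%:R) -> strongly_measurable f.
Proof.
move=> mf fb.
(* The summand [b] keeps the truncation inactive, as the coefficients are bounded by [b]; the square
   makes the [M] rounding errors add up to at most 2/(M+1). *)
pose k M := (M.+1 * M.+1 + b)%N.
pose s M x := \sum_(m < M) cround (k M) (dotp (f x) (a m)) *: a m.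
have a1 m : nrm (a m) <= 1 by have [_ a1 _] := aP; have [->//|->] := a1 m; rewrite nrm0.
have fb' x m : csq (dotp (f x) (a m)) <= b%:R ^+ 2.
  apply: le_trans (dotp_CS _ _) _; rewrite -[leRHS]mulr1 ler_pM ?sqr_ge0//.
    by rewrite ler_pXn2r ?nnegrE ?nrm_ge0.
  by rewrite expr_le1 ?nrm_ge0.
exists s; split=> [M|x].
  rewrite /s; move: (k M) => K; elim: M => [|M IH].
    under eq_fun do rewrite big_ord0.
    split=> [|y]; first by apply: (@sub_finite_set _ _ [set 0]) => // _ [x _ <-].
    have [->|y0] := pselect (y = 0).
      by rewrite (_ : _ @^-1` _ = setT)//; apply/seteqP; split.
    by rewrite (_ : _ @^-1` _ = set0)//; apply/seteqP; split => // x /esym.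
  under eq_fun do rewrite big_ord_recr /=.
  apply: (@simple_map_comp _ _ _ _ (fun x => (\sum_(m < M) cround K (dotp (f x) (a m)) *: a m,
    cround K (dotp (f x) (a M)))) (fun p => p.1 + p.2 *: a M)).
  by apply: simple_map_pair => //; exact: simple_cround.
apply: cvg_nrmP => e e0.
have [N1 N1P] := basis_seq_expansion H_complete aP (f x) (divr_gt0 e0 (ltr0n R 2)).
have [N2 N2P] := eventually_inv_lt (divr_gt0 e0 (ltr0n R 4)).
exists (maxn N1 N2) => M; rewrite geq_max => /andP[M1 M2].
apply: le_lt_trans (nrm_dist_le _ (\sum_(m < M) dotp (f x) (a m) *: a m) _) _.
rewrite [ltRHS]splitr ltr_leD ?N1P//.
have sumle (N : nat) (r : R) (h : 'I_N -> H) : (forall m, nrm (h m) <= r) ->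
    nrm (\sum_(m < N) h m) <= N%:R * r.
  elim: N h => [|N IH] h hr; first by rewrite big_ord0 nrm0 mul0r.
  rewrite big_ord_recr /= (le_trans (nrmD _ _))// -natr1 mulrDl mul1r.
  by rewrite lerD// IH.
rewrite /s -sumrB; apply: (@le_trans _ _ (M%:R * ((k M).+1%:R^-1 *+ 2))).
  apply: sumle => m; rewrite -scalerBl nrmZl -[leRHS]mulr1 ler_pM ?nrm_ge0//.
  have bb (u v : R) : u ^+ 2 + v ^+ 2 <= b%:R ^+ 2 -> `|u| <= (k M)%:R.
    move=> uv; apply: (@le_trans _ _ b%:R); last by rewrite ler_nat leq_addl.
    rewrite -(ler_pXn2r (n := 2)) ?nnegrE// real_normK ?num_real//.
    by have := sqr_ge0 v; lra.
  apply: cround_error; first exact: bb (fb' x m).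
  by apply: bb; rewrite addrC; exact: fb'.
have := N2P M M2.
have : M%:R * (k M).+1%:R^-1 <= M.+1%:R^-1 :> R.
  rewrite ler_pdivrMr// ler_pdivlMl// -natrM ler_nat /k.
  by rewrite (@leq_trans (M.+1 * M.+1))// ?leq_mul// -addnS leq_addr.
rewrite mulrnAr; move: (M.+1%:R^-1) (M%:R * _) => u v; lra.
Qed.

End strong_measurability.

(** * Completeness of L^2 *)

Section geometric_convergence.
Variable R : realType.

(** The radius 2 s 2^-n is the tail of the geometric series, so the intervals of that radius around
    [a n] are nested; the limit is the supremum of their left endpoints. This yields the rate along
    with the limit. *)
Lemma geometric_cvg_real (a : nat -> R) (s : R) :
  (forall j, `|a j.+1 - a j| <= s * 2^-1 ^+ j) ->
  exists l, forall n, `|a n - l| <= 2 * s * 2^-1 ^+ n.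
Proof.
move=> asj; pose r n := 2 * s * 2^-1 ^+ n.
have s0 : 0 <= s by have := asj 0; rewrite expr0 mulr1; exact: le_trans.
have r0 n : 0 <= r n by rewrite !mulr_ge0// exprn_ge0.
have rS n : r n = r n.+1 + s * 2^-1 ^+ n by rewrite /r exprS; field.
have up n : a n - r n <= a n.+1 - r n.+1.
  by have := asj n; rewrite ler_norml => /andP[+ _]; have := rS n; lra.
have dn n : a n.+1 + r n.+1 <= a n + r n.
  by have := asj n; rewrite ler_norml => /andP[_]; have := rS n; lra.
have ups m n : (m <= n)%N -> a m - r m <= a n - r n.
  move=> /subnK <-; elim: (n - m)%N => // k IH; exact: le_trans IH (up _).
have dns m n : (m <= n)%N -> a n + r n <= a m + r m.
  move=> /subnK <-; elim: (n - m)%N => // k IH; exact: le_trans (dn _) IH.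
have ud m n : a m - r m <= a n + r n.
  apply: (@le_trans _ _ (a (maxn m n) - r (maxn m n))); first exact/ups/leq_maxl.
  apply: (@le_trans _ _ (a (maxn m n) + r (maxn m n))); last exact/dns/leq_maxr.
  by have := r0 (maxn m n); lra.
pose A := range (fun n => a n - r n).
have Aub n : ubound A (a n + r n) by move=> _ [m _ <-].
have A0 : A !=set0 by exists (a 0 - r 0), 0.
exists (sup A) => n.
have h1 : a n - r n <= sup A by apply: ub_le_sup; [exists (a 0 + r 0)|exists n].
have h2 : sup A <= a n + r n by exact: ge_sup.
by rewrite ler_norml -/(r n); apply/andP; split; lra.
Qed.

(** Each coordinate has increments at most sqrt(c) 2^-j, hence a squared error of at most 4 c 4^-n;
    the two coordinates together give 8 c. *)
Lemma geometric_cvg_complex (z : nat -> R[i]) (c : R) :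
  (forall j, 4 ^+ j * csq (z j.+1 - z j) <= c) ->
  exists l, forall n, csq (z n - l) <= 8 * c * 4^-1 ^+ n.
Proof.
move=> zc; have c0 : 0 <= c.
  by apply: le_trans (zc 0); rewrite expr0 mul1r csq_ge0.
have z2 j : csq (z j.+1 - z j) <= c * 4^-1 ^+ j.
  by rewrite exprVn ler_pdivlMr ?exprn_gt0// mulrC.
have part (h : R[i] -> R) : (forall x y, h (x - y) = h x - h y) ->
    (forall x, h x ^+ 2 <= csq x) ->
    exists l, forall n, (h (z n) - l) ^+ 2 <= 4 * c * 4^-1 ^+ n.
  move=> hB hc.
  have e42 n : 4^-1 ^+ n = (2^-1 ^+ n) ^+ 2 :> R.
    by rewrite -exprM mulnC exprM; congr (_ ^+ _); field.
  have [|l lP] := @geometric_cvg_real (fun n => h (z n)) (Num.sqrt c).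
    move=> j; rewrite -hB -(ler_pXn2r (n := 2)) ?nnegrE ?mulr_ge0 ?sqrtr_ge0 ?exprn_ge0//.
    rewrite real_normK ?num_real// exprMn sqr_sqrtr// -e42.
    exact: le_trans (hc _) (z2 j).
  exists l => n; have := lP n.
  rewrite -(ler_pXn2r (n := 2)) ?nnegrE ?mulr_ge0 ?sqrtr_ge0 ?exprn_ge0//.
  rewrite real_normK ?num_real// !exprMn sqr_sqrtr// -e42.
  by rewrite (_ : 2 ^+ 2 = 4 :> R)//; ring.
have [lr lrP] := part (@complex.Re R) ltac:(by move=> [? ?] [? ?])
  ltac:(by move=> x; rewrite /csq lerDl sqr_ge0).
have [li liP] := part (@complex.Im R) ltac:(by move=> [? ?] [? ?])
  ltac:(by move=> x; rewrite /csq lerDr sqr_ge0).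
exists (lr +i* li)%C => n; have := lrP n; have := liP n; case: (z n) => a b.
by rewrite /csq /=; lra.
Qed.

End geometric_convergence.

Section L2_theory.
Context d (T : measurableType d) (R : realType) (mu : {measure set T -> \bar R}).

Section values.
Context (H : innerProductType R).
Local Notation L2H := (L2 mu H).

Lemma L2_sq (x : L2H) : sq_integrable mu (L2_fun x).
Proof. exact: L2fun_sq. Qed.

Lemma L2_sm (x : L2H) : strongly_measurable (L2_fun x).
Proof. exact: (L2_sq x).1. Qed.

Lemma L2_linE a (x y : L2H) :
  {ae mu, forall t, L2_fun (a *: x + y) t = a *: L2_fun x t + L2_fun y t}.
Proof.
have [f fx] := L2_piP x; have [g gy] := L2_piP y.
have hf := L2_reprP f; have hg := L2_reprP g; have hfg := L2_reprP (a *: f + g).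
rewrite -fx in hf; rewrite -gy in hg.
have e : (a *: x + y) = (\pi_(L2 mu H) (a *: f + g))%qT by rewrite fx gy L2_piZ L2_piD.
rewrite -e in hfg.
by move: hf hg hfg; apply: filterS3 => t -> -> ->; rewrite L2funDE L2funZE.
Qed.

Lemma L2_subE (x y : L2H) :
  {ae mu, forall t, L2_fun (x - y) t = L2_fun x t - L2_fun y t}.
Proof.
have := L2_linE (-1) y x; rewrite scaleN1r addrC; apply: filterS => t ->.
by rewrite scaleN1r addrC.
Qed.

Lemma dotp_integrable (f g : T -> H) : sq_integrable mu f -> sq_integrable mu g ->
  mu.-integrable setT (fun t => (complex.Re (dotp (f t) (g t)))%:E) /\
  mu.-integrable setT (fun t => (complex.Im (dotp (f t) (g t)))%:E).
Proof.
move=> /sq_integrableP[mf fi] /sq_integrableP[mg gi].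
by split; apply: le_integrable (integrableD measurableT fi gi) => //;
  [exact/measurable_EFinP/measurable_Re_dotp|
   move=> t _ /=; rewrite lee_fin (le_trans (Re_dotp_le _ _))// ler_norm|
   exact/measurable_EFinP/measurable_Im_dotp|
   move=> t _ /=; rewrite lee_fin (le_trans (Im_dotp_le _ _))// ler_norm].
Qed.

Lemma L2_dot_integrable (x y : L2H) :
  mu.-integrable setT (fun t => (complex.Re (dotp (L2_fun x t) (L2_fun y t)))%:E) /\
  mu.-integrable setT (fun t => (complex.Im (dotp (L2_fun x t) (L2_fun y t)))%:E).
Proof. by apply: dotp_integrable; exact: L2_sq. Qed.

Lemma L2_Re_dot (x y : L2H) : (complex.Re (dotp x y))%:E =
  (\int[mu]_t (complex.Re (dotp (L2_fun x t) (L2_fun y t)))%:E)%E.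
Proof.
rewrite L2_dotE /= /Rintegral fineK//.
exact: integrable_fin_num (L2_dot_integrable x y).1.
Qed.

Lemma L2_Im_dot (x y : L2H) : (complex.Im (dotp x y))%:E =
  (\int[mu]_t (complex.Im (dotp (L2_fun x t) (L2_fun y t)))%:E)%E.
Proof.
rewrite L2_dotE /= /Rintegral fineK//.
exact: integrable_fin_num (L2_dot_integrable x y).2.
Qed.

Lemma L2_dot_ae (x y : L2H) (f g : T -> H) :
  strongly_measurable f -> strongly_measurable g ->
  {ae mu, forall t, L2_fun x t = f t} -> {ae mu, forall t, L2_fun y t = g t} ->
  (complex.Re (dotp x y))%:E = (\int[mu]_t (complex.Re (dotp (f t) (g t)))%:E)%E /\
  (complex.Im (dotp x y))%:E = (\int[mu]_t (complex.Im (dotp (f t) (g t)))%:E)%E.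
Proof.
move=> mf mg xf yg; rewrite L2_Re_dot L2_Im_dot; split; apply: ae_eq_integral => //;
  try by apply/measurable_EFinP; (apply: measurable_Re_dotp || apply: measurable_Im_dotp) => //;
    exact: L2_sm.
- by move: xf yg; apply: filterS2 => t -> -> _.
- by move: xf yg; apply: filterS2 => t -> -> _.
Qed.

Lemma L2_nrm2 (x : L2H) : (nrm x ^+ 2)%:E = (\int[mu]_t (nrm (L2_fun x t) ^+ 2)%:E)%E.
Proof.
have := L2_Re_dot x x; rewrite dotp_nrm /= => ->.
by apply: eq_integral => t _; rewrite dotp_nrm.
Qed.

Lemma L2_nrm2_ae (x : L2H) (f : T -> H) : strongly_measurable f ->
  {ae mu, forall t, L2_fun x t = f t} ->
  (nrm x ^+ 2)%:E = (\int[mu]_t (nrm (f t) ^+ 2)%:E)%E.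
Proof.
move=> mf xf; rewrite L2_nrm2; apply: ge0_ae_eq_integral => //.
- exact/measurable_EFinP/measurable_nrm2/L2_sm.
- exact/measurable_EFinP/measurable_nrm2.
- by move=> t _; rewrite lee_fin sqr_ge0.
- by move=> t _; rewrite lee_fin sqr_ge0.
- by apply: filterS xf => t -> _.
Qed.

Lemma L2_ext (x y : L2H) : {ae mu, forall t, L2_fun x t = L2_fun y t} -> x = y.
Proof.
by move=> xy; rewrite -[x]reprK -[y]reprK; apply/L2_eqP.
Qed.

End values.

(** Riesz-Fischer with rates. Along a subsequence with squared increments at most 8^-j, the function
    [C], the sum of the 4^j |v_(j+1) - v_j|^2, has integral at most 2. Where [C] is finite the
    values converge with squared error at most 8 C 4^-n, and integrating this bound gives
    convergence in norm directly. *)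
Lemma L2_complete : seq_complete (L2 mu R[i]^o).
Proof.
move=> u uC.
pose del j : R := Num.sqrt (8^-1 ^+ j).
have del0 j : 0 < del j by rewrite sqrtr_gt0 exprn_gt0// invr_gt0.
have [k kP] := choice (fun j => uC (del j) (del0 j)).
(* Partial sums make the indices increasing while keeping [K j] above [k j]. *)
pose K j := (\sum_(i < j.+1) (k i).+1)%N.
have kK j : (k j <= K j)%N.
  by rewrite /K big_ord_recr /= (leq_trans (leqnSn _))// leq_addl.
have KS j : (K j <= K j.+1)%N by rewrite [leqRHS]/K big_ord_recr leq_addr.
have jK j : (j <= K j)%N.
  elim: j => // j IH; rewrite /K big_ord_recr /= addnS ltnS (leq_trans IH)// leq_addr//.
pose v j := u (K j).
have vS j : nrm (v j.+1 - v j) ^+ 2 <= 8^-1 ^+ j.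
  have := kP j (K j.+1) (K j) (leq_trans (kK j) (KS j)) (kK j).
  rewrite -(ltr_pXn2r (n := 2)) ?nnegrE ?nrm_ge0 ?(ltW (del0 _))//.
  by rewrite sqr_sqrtr ?exprn_ge0 ?invr_ge0// => /ltW.
pose D j := L2_fun (v j.+1 - v j).
pose h j t := (4 ^+ j * nrm (D j t) ^+ 2)%:E.
have h0 j t : (0 <= h j t)%E by rewrite lee_fin mulr_ge0 ?exprn_ge0 ?nrm_ge0.
have mh j : measurable_fun setT (h j).
  by apply/measurable_EFinP; apply: measurable_funM => //; apply/measurable_nrm2/L2_sm.
pose C t := (\sum_(j <oo) h j t)%E.
have C0 t : (0 <= C t)%E by apply: nneseries_ge0 => j _ _; exact: h0.
have mC : measurable_fun setT C by exact: ge0_emeasurable_sum.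
have iC : (\int[mu]_t C t <= 2%:E)%E.
  rewrite integral_nneseries//.
  apply: le_trans (epsilon_trick0 xpredT (ltW (ltr0n R 2))).
  apply: lee_nneseries => [j _ _|j _]; first by apply: integral_ge0 => t _; exact: h0.
  rewrite /h; under eq_integral do rewrite EFinM.
  rewrite ge0_integralZl_EFin ?exprn_ge0//; last 2 first.
  - by move=> t _; rewrite lee_fin sqr_ge0.
  - exact/measurable_EFinP/measurable_nrm2/L2_sm.
  rewrite -L2_nrm2 -EFinM lee_fin.
  apply: (@le_trans _ _ (4 ^+ j * 8^-1 ^+ j)); first by rewrite ler_pM2l ?exprn_gt0.
  rewrite -exprMn natrX exprS invfM mulrA divff// mul1r -exprVn le_eqVlt; apply/orP; left.
  by apply/eqP; congr (_ ^+ _); field.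
have intC : mu.-integrable setT C.
  apply/integrableP; split => //; under eq_integral do rewrite gee0_abs//.
  exact: le_lt_trans iC (ltry _).
have Cfin := integrable_ae measurableT intC.
have subE := ae_foralln (fun j => L2_subE (v j.+1) (v j)).
have [N [mN N0 NP]] : mu.-negligible [set t | ~ (C t \is a fin_num /\
    forall j, D j t = L2_fun (v j.+1) t - L2_fun (v j) t)].
  by move: Cfin subE; apply: filterS2 => t /(_ I) Ct Dt; split.
(* Erasing the null set [N] makes the increment bound hold at every point, so that the limit is
   defined and measurable everywhere. *)
pose f j t := if t \in N then 0 else L2_fun (v j) t.
have mf j : complex_measurable (f j).
  have [mr mi] := complex_measurable_sm (L2_sm (v j)).
  have mm : measurable_fun setT (fun t => t \in N).
    apply: (measurable_fun_bool true); rewrite setTI (_ : _ @^-1` _ = N)//.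
    by apply/seteqP; split => t /=; [move/set_mem|move/mem_set].
  split.
    rewrite (_ : (fun t => _) = fun t => if t \in N then 0 else complex.Re (L2_fun (v j) t)).
      exact: measurable_fun_ifT.
    by apply/funext => t; rewrite /f; case: ifP.
  rewrite (_ : (fun t => _) = fun t => if t \in N then 0 else complex.Im (L2_fun (v j) t)).
    exact: measurable_fun_ifT.
  by apply/funext => t; rewrite /f; case: ifP.
have fC t j : 4 ^+ j * csq (f j.+1 t - f j t) <= fine (C t).
  rewrite /f; case: ifPn => [_|/negP tN]; first by rewrite subrr csq0 mulr0 fine_ge0.
  have [Ct Dt] : C t \is a fin_num /\ forall j, D j t = L2_fun (v j.+1) t - L2_fun (v j) t.
    by apply: contrapT => /NP Nt; apply: tN; exact: mem_set.
  rewrite -Dt -nrm_csq -lee_fin fineK//.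
  apply: (@le_trans _ _ (\sum_(0 <= i < j.+1) h i t)%E).
    by rewrite big_nat_recr//= leeDr// sume_ge0.
  by apply: nneseries_lim_ge => i _ _; exact: h0.
have [l lP] := choice (fun t => geometric_cvg_complex (fC t)).
have ml : complex_measurable l.
  have cv (p : R[i] -> R) : (forall x y, p (x - y) = p x - p y) ->
      (forall x, p x ^+ 2 <= csq x) -> (forall j, measurable_fun setT (fun t => p (f j t))) ->
      measurable_fun setT (fun t => p (l t)).
    move=> pB pc mp; apply: (@measurable_fun_cvg _ _ _ _ (fun j t => p (f j t))) => // t _.
    apply/cvgrPdist_lt => e e0; near=> n.
    rewrite distrC -pB -(ltr_pXn2r (n := 2)) ?nnegrE ?(ltW e0)//.
    rewrite real_normK ?num_real// (le_lt_trans (pc _))//.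
    apply: le_lt_trans (lP t n) _; near: n.
    have : (fun n => 8 * fine (C t) * 4^-1 ^+ n) @ \oo --> 8 * fine (C t) * 0.
      by apply: cvgM; [exact: cvg_cst|apply: cvg_expr; rewrite ger0_norm ?invf_lt1// ltr1n].
    rewrite mulr0 => /cvgrPdist_lt /(_ _ (exprn_gt0 2 e0)); apply: filterS => n.
    by rewrite sub0r normrN; apply: le_lt_trans; exact: ler_norm.
  have [h1 h2] := all_and2 mf; split; apply: cv => //.
  - by move=> [? ?] [? ?].
  - by move=> x; rewrite /csq lerDl sqr_ge0.
  - by move=> [? ?] [? ?].
  - by move=> x; rewrite /csq lerDr sqr_ge0.
have cmB (g g' : T -> R[i]) : complex_measurable g -> complex_measurable g' ->
    complex_measurable (fun t => g t - g' t).
  move=> [g1 g2] [g3 g4]; split.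
    rewrite (_ : (fun t => _) = fun t => complex.Re (g t) - complex.Re (g' t)).
      exact: measurable_funB.
    by apply/funext => t; case: (g t) (g' t) => [? ?] [? ?].
  rewrite (_ : (fun t => _) = fun t => complex.Im (g t) - complex.Im (g' t)).
    exact: measurable_funB.
  by apply/funext => t; case: (g t) (g' t) => [? ?] [? ?].
pose w n t : R[i]^o := f n t - l t.
have mw n : strongly_measurable (w n) by apply: strongly_measurable_complex; exact: cmB.
have iw n : (\int[mu]_t (nrm (w n t) ^+ 2)%:E <= (16 * 4^-1 ^+ n)%:E)%E.
  apply: (@le_trans _ _ (\int[mu]_t ((8 * 4^-1 ^+ n)%:E * C t))%E).
    apply: ge0_le_integral => //.
    - by move=> t _; rewrite lee_fin sqr_ge0.
    - exact/measurable_EFinP/measurable_nrm2.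
    - by apply: emeasurable_funM => //; exact: measurable_cst.
    - move=> t _; rewrite nrm_csq.
      case: (C t) (C0 t) (lP t n) => [c c0 /= h1||//]; last first.
        by move=> _ _; rewrite gt0_muley ?leey// lte_fin mulr_gt0// exprn_gt0 ?invr_gt0.
      by rewrite -EFinM lee_fin mulrAC.
  have k0 : 0 <= 8 * 4^-1 ^+ n :> R by rewrite mulr_ge0// exprn_ge0 ?invr_ge0.
  rewrite ge0_integralZl_EFin//.
  rewrite (_ : 16 * _ = (8 * 4^-1 ^+ n) * 2); last by ring.
  by rewrite [leRHS]EFinM lee_pmul2l// lte_fin mulr_gt0// exprn_gt0 ?invr_gt0.
have sw : sq_integrable mu (w 0) by split => //; exact: le_lt_trans (iw 0) (ltry _).
(* This is the class of [l]: the square integrability of [l] comes through that of the difference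
   w_0 = f_0 - l, which [iw] provides. *)
pose L := v 0 - toL2 mu (w 0).
have vL n : nrm (v n - L) ^+ 2 <= 16 * 4^-1 ^+ n.
  rewrite -lee_fin; apply: le_trans (iw n).
  rewrite le_eqVlt; apply/orP; left; apply/eqP; apply: L2_nrm2_ae => //.
  have fv : {ae mu, forall t, forall j, f j t = L2_fun (v j) t}.
    exists N; split => // t /= /existsNP[j fj]; apply: contrapT => tN; apply: fj.
    by rewrite /f memNset.
  have e1 := L2_subE (v n) L; have e2 := L2_subE (v 0) (toL2 mu (w 0)).
  have e3 := toL2P sw.
  have e12 : {ae mu, forall t, L2_fun (v n - L) t =
      L2_fun (v n) t - (L2_fun (v 0) t - L2_fun (toL2 mu (w 0)) t)}.
    by move: e1 e2; apply: filterS2 => t -> ->.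
  move: e12 e3 fv; apply: filterS3 => t -> -> fv.
  by rewrite /w !fv subKr.
exists L => e e0; have [N1 N1P] := uC (e / 2) ltac:(by rewrite divr_gt0).
have [j [jN1 jL]] : exists j, (N1 <= j)%N /\ nrm (v j - L) < e / 2.
  have [N2 N2P] := eventually_inv_lt
    (divr_gt0 (exprn_gt0 2 (divr_gt0 e0 (ltr0n R 2))) (ltr0n R 16)).
  exists (maxn N1 N2); split; first exact: leq_maxl.
  set j := maxn _ _.
  rewrite -(ltr_pXn2r (n := 2)) ?nnegrE ?nrm_ge0 ?divr_ge0 ?(ltW e0)//.
  have := N2P j (leq_maxr _ _); rewrite ltr_pdivlMr//.
  apply: le_lt_trans; rewrite (le_trans (vL j))// mulrC ler_pM2r// exprVn.
  rewrite lef_pV2 ?posrE ?exprn_gt0// -natrX ler_nat.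
  exact: (ltn_expl j (isT : 1 < 4)%N).
exists N1 => n Nn; apply: le_lt_trans (nrm_dist_le _ (v j) _) _.
by rewrite [ltRHS]splitr ltrD// N1P// (leq_trans jN1).
Unshelve. all: by end_near. Qed.

End L2_theory.

(** * Countable networks and sigma-finiteness *)

Section networks.

(* The members of a network need not be open. *)
Definition countable_network (X : topologicalType) (b : nat -> set X) :=
  forall x U, nbhs x U -> exists2 n, b n x & b n `<=` U.

Definition has_countable_network (X : topologicalType) :=
  exists b : nat -> set X, countable_network b.

Lemma countable_networkP (X : topologicalType) (I : countType) (c : I -> set X) :
  (forall x U, nbhs x U -> exists2 i, c i x & c i `<=` U) -> has_countable_network X.
Proof.
move=> cP; exists (fun n => if unpickle n is Some i then c i else set0) => x U xU.
by have [i cx cU] := cP x U xU; exists (pickle i); rewrite pickleK.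
Qed.

Lemma second_countable_network (X : topologicalType) : @second_countable X ->
  exists b : nat -> set X, (forall n, open (b n)) /\ countable_network b.
Proof.
move=> [B /countable_injP[f fI] [Bo Bx]].
exists (fun n => xget set0 [set U | B U /\ f U = n]); split=> [n|x U xU].
  by case: xgetP => [U _ [BU _]|_]; [exact: Bo|exact: open0].
have [V [BV Vx] VU] := Bx x U xU; exists (f V).
  case: xgetP => [W _ [BW fWV]|/(_ V)/not_andP[]//].
  by rewrite (fI W V (mem_set BW) (mem_set BV) fWV).
case: xgetP => [W _ [BW fWV]|/(_ V)/not_andP[]//].
by rewrite (fI W V (mem_set BW) (mem_set BV) fWV).
Qed.

(** An open set is the union of the members of [b] that it contains, and these are countably
    many. *)
Lemma network_generates (X : ptopologicalType) (b : nat -> set X) (U : set X) :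
  countable_network b -> open U -> <<s range b >> U.
Proof.
move=> bP oU.
have -> : U = \bigcup_n (if `[< b n `<=` U >] then b n else set0).
  apply/seteqP; split => [x Ux|x [n _]]; last by case: ifPn => // /asboolP; exact.
  have [n bx bU] := bP x U (open_nbhs_nbhs (conj oU Ux)).
  by exists n => //; rewrite asboolT.
apply: sigma_algebra_bigcup => n; case: ifPn => _; last exact: sigma_algebra0.
by apply: sub_gen_smallest; exists n.
Qed.

End networks.

Section rational_complex.
Variable R : realType.

Definition cratr (p : rat * rat) : R[i]^o := (ratr p.1 +i* ratr p.2)%C.

Lemma cratr_dense (z : R[i]^o) (e : R) : 0 < e ->
  exists p, nrm (z - cratr p) < e.
Proof.
move=> e0; have h (x : R) : exists q : rat, `|x - ratr q| <= e / 2.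
  have [|q] := @rat_in_itvoo R (x - e / 2) (x + e / 2); first by lra.
  rewrite in_itv /= => /andP[q1 q2]; exists q; rewrite ler_norml.
  by apply/andP; split; lra.
have [p pP] := h (complex.Re z); have [q qP] := h (complex.Im z); exists (p, q).
rewrite -(ltr_pXn2r (n := 2)) ?nnegrE ?nrm_ge0 ?(ltW e0)// nrm_csq /csq.
move: pP qP; case: z => a b /=; rewrite !ler_norml => /andP[p1 p2] /andP[q1 q2].
by nra.
Qed.

Definition cball (i : (rat * rat) * nat) : set R[i]^o :=
  [set z : R[i]^o | nrm (z - cratr i.1) < i.2.+1%:R^-1].

Lemma cball_open i : open (cball i).
Proof.
have -> : cball i = ball (cratr i.1) (i.2.+1%:R^-1)%:C%C.
  rewrite /cball -ball_normE; apply/seteqP; split => z /=; by rewrite nrmE ltcR nrmBC.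
by apply: ball_open; rewrite ltcR invr_gt0.
Qed.

Lemma cball_basis (z : R[i]^o) U : nbhs z U -> exists2 i, cball i z & cball i `<=` U.
Proof.
move=> /nbhs_ballP[e /= e0 eU].
have [er ei] : 0 < complex.Re e /\ complex.Im e = 0.
  by move: e0; case: (e) => a b; rewrite ltcE /= => /andP[/eqP -> ->].
have [k /(_ _ (leqnn k)) kP] := eventually_inv_lt (divr_gt0 er (ltr0n R 2)).
have k0 : 0 < k.+1%:R^-1 :> R by rewrite invr_gt0.
have [p pz] := cratr_dense z k0.
exists (p, k) => // w wk; apply: eU; rewrite -ball_normE /= nrmE.
have : nrm (z - w) < complex.Re e.
  apply: le_lt_trans (nrm_dist_le _ (cratr p) _) _; rewrite [nrm (_ - w)]nrmBC.
  by move: kP pz wk; rewrite /cball /=; move: (k.+1%:R^-1) => r; lra.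
by move: ei; case: (e) => a b /= ->; rewrite ltcR.
Qed.

End rational_complex.

Section dual_network.
Context (R : realType) (G : topGroupType).

(** The members are given by finitely many conditions g(b_n) in D, with b_n basic in [G] and D a
    rational disc. As b_n need not be relatively compact, such sets need not be open, hence a
    network. They are fine enough: if chi(K) lies in W, compactness covers [K] by finitely many b_n
    that chi maps into discs inside W. *)
Lemma dual_network : @second_countable G -> has_countable_network (dual R G).
Proof.
move=> /second_countable_network[b [bo bP]].
pose c (l : seq (nat * ((rat * rat) * nat))) : set {compact-open, G -> R[i]^o} :=
  [set g | forall p, p \in l -> g @` b p.1 `<=` @cball R p.2].
apply: (@countable_networkP _ _ (fun l => @dual_to_compact_open R G @^-1` c l)) => chi U.
move=> [_ [[V oV <-] /= Vchi VU]].
pose chi' : {compact-open, G -> R[i]^o} := dual_to_compact_open chi.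
pose Fl := filter_from [set l | c l chi'] c.
have FlF : Filter Fl.
  apply: filter_from_filter; first by exists [::].
  move=> l1 l2 c1 c2; exists (l1 ++ l2).
    by move=> p; rewrite mem_cat => /orP[/c1|/c2].
  by move=> g gc; split=> p pl; apply: gc; rewrite mem_cat pl ?orbT.
have Fchi : Fl --> chi'.
  apply/compact_open_cvgP => K W cK oW KW.
  have [cchi _ _] := dualP chi.
  pose D := [set p : nat * ((rat * rat) * nat) |
    chi' @` b p.1 `<=` @cball R p.2 /\ @cball R p.2 `<=` W].
  have : @cover_compact (pointed_at0 G) K by rewrite -compact_cover.
  move=> /(_ _ D (fun p => b p.1)).
  case=> [p _|x Kx|D' D'D KD']; first exact: bo.
    have Wx : nbhs (chi x) W by apply: open_nbhs_nbhs; split => //; apply: KW; exists x.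
    have [j jx jW] := cball_basis Wx.
    have : nbhs x (chi @^-1` @cball R j).
      by apply: cchi; apply: open_nbhs_nbhs; split => //; exact: cball_open.
    move=> /bP[n bx bj]; exists (n, j) => //; split => // _ [y /bj yj <-].
    exact: yj.
  exists (finmap.enum_fset D').
    by move=> p /D'D/set_mem[].
  move=> g gc _ [x /KD'[p /= pD' bpx] <-].
  have [_] := set_mem (D'D _ pD'); apply; apply: (gc p) => //; by exists x.
have [l lc lV] := Fchi _ (open_nbhs_nbhs (conj oV Vchi)).
by exists l => // psi /lV Vpsi; exact: VU.
Qed.

End dual_network.

Section section_cover.
Context (R : realType) (A : topGroupType) (B : zmodClosed A) (S : borel_section B).

Lemma section_network (b : nat -> set A) : countable_network b ->
  countable_network (fun n => set_val @^-1` b n : set (section_type S)).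
Proof.
move=> bP x U [_ [[V oV <-] /= Vx VU]].
have [n bx bV] := bP _ _ (open_nbhs_nbhs (conj oV Vx)).
by exists n => // y by'; apply: VU; exact: bV.
Qed.

(** By local finiteness each coset has an open neighbourhood of finite measure. For each network
    member whose image fits into some such open set, one is chosen (the empty set otherwise); the
    chosen sets cover the quotient and are pulled back to the section. *)
Lemma section_sigma_finite (m : {measure set (borel (section_type S)) -> \bar R}) :
  has_countable_network A -> section_haar_measure m ->
  exists W : nat -> set (borel (section_type S)),
    [/\ forall n, measurable (W n), forall n, (m (W n) < +oo)%E & \bigcup_n W n = setT].
Proof.
move=> [b bP] [nu [_ _ nu_fin _] mnu].
pose good n (V : set (quotient_group B)) :=
  [/\ open V, (nu V < +oo)%E & forall a, b n a -> V (\pi_(quotient_group B) a)%qT].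
pose V n : set (quotient_group B) := xget set0 (good n).
have Vo n : open (V n) by rewrite /V; case: xgetP => [U _ []//|_]; exact: open0.
have Vfin n : (nu (V n) < +oo)%E.
  by rewrite /V; case: xgetP => [U _ []//|_]; rewrite measure0 ltry.
have mV n : measurable (V n : set (gborel (quotient_group B))).
  by apply: sub_sigma_algebra; exact: Vo.
exists (fun n => @section_coset A B S @^-1` V n); split.
- move=> n; apply: sub_sigma_algebra.
  by exists ((\pi_(quotient_group B))%qT @^-1` V n); first exact: Vo.
- by move=> n; rewrite mnu.
- apply/seteqP; split => // s _.
  have [U [oU Us nuU]] := nu_fin (@section_coset A B S s).
  have oU' : open ((\pi_(quotient_group B))%qT @^-1` U : set A) by exact: oU.
  have [n bn bU] := bP (set_val (s : section_type S)) _ (open_nbhs_nbhs (conj oU' Us)).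
  exists n => //; rewrite /= /V; case: xgetP => [U' _ [_ _ h]|/(_ U) h]; first exact: h.
  by exfalso; apply: h; split.
Qed.

End section_cover.

(** * Separability of L^2 *)

Section L2_separable.
Context d (T : measurableType d) (R : realType) (mu : {measure set T -> \bar R}).

(** The measurable sets over which [f] integrates to 0 form a Dynkin system; complements are allowed
    because the whole space belongs to the family [P]. *)
Lemma ae0_pi_system (J : Type) (P : J -> set T) (f : T -> R) :
  mu.-integrable setT (EFin \o f) ->
  @measurable _ T = <<s range P >> -> setI_closed (range P) -> (exists i, P i = setT) ->
  (forall i, (\int[mu]_(x in P i) (f x)%:E = 0)%E) ->
  {ae mu, forall x, f x = 0}.
Proof.
move=> fi PE PI [iT PT] f0.
have mP i : measurable (P i) by rewrite PE; apply: sub_gen_smallest; exists i.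
have mf : measurable_fun setT (EFin \o f) by exact: measurable_int fi.
have fT : (\int[mu]_x (f x)%:E = 0)%E by rewrite -PT f0.
suff h S : <<s range P >> S -> (\int[mu]_(x in S) (f x)%:E = 0)%E.
  have : ae_eq mu setT (EFin \o f) (cst 0%E).
    apply: integral_ae_eq => // S _ mS; rewrite integral0 -(h S)//.
    by rewrite -PE.
  by apply: filterS => x /(_ I) [].
apply: (dynkin_induction (P := fun S => (\int[mu]_(x in S) (f x)%:E = 0)%E)) => //.
- by move=> _ [i _ <-].
- move=> A mA A0; have := fT; rewrite -(setUv A) integral_setU//; last 3 first.
  + exact: measurableC.
  + by rewrite setUv.
  + by apply/disj_setPCl.
  by rewrite A0 add0e.
- move=> F mF tF F0; rewrite integral_bigcup//.
    by rewrite eseries0// => i _ _; rewrite F0.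
  by apply: integrableS fi => //; exact: bigcup_measurable.
Qed.

Definition indc (A : set T) (t : T) : R[i]^o := ((\1_A t)%:C)%C.

Lemma indc_sq A : measurable A -> (mu A < +oo)%E -> sq_integrable mu (indc A).
Proof.
move=> mA Afin; split.
  apply: strongly_measurable_complex; split; first exact: measurable_indic.
  exact: measurable_cst.
suff -> : (\int[mu]_t (nrm (indc A t) ^+ 2)%:E = \int[mu]_t (\1_A t)%:E)%E.
  by rewrite integral_indic// setIT.
apply: eq_integral => t _; rewrite nrm_csq csq_real indicE.
by case: (t \in A); rewrite ?expr1n ?expr0n.
Qed.

(** The sequence lists the indicators of the sets [W k] cut by finite intersections of the [b n].
    These intersections are a generating pi-system, so a function orthogonal to all of them vanishes
    a.e. on each [W k]. *)
Lemma L2_total_seq (W b : nat -> set T) :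
  (forall n, measurable (W n)) -> (forall n, (mu (W n) < +oo)%E) -> \bigcup_n W n = setT ->
  (forall n, measurable (b n)) -> (forall S, measurable S -> <<s range b >> S) ->
  exists u : nat -> L2 mu R[i]^o, forall x, (forall n, dotp x (u n) = 0) -> x = 0.
Proof.
move=> mW Wfin WT mb bgen.
pose P (l : seq nat) := \big[setI/setT]_(i <- l) b i.
have mP l : measurable (P l).
  by rewrite /P; elim/big_ind : _ => //; exact: measurableI.
have PE : @measurable _ T = <<s range P >>.
  apply/seteqP; split => [S /bgen|].
    apply: smallest_sub; first exact: smallest_sigma_algebra.
    by move=> _ [n _ <-]; apply: sub_gen_smallest; exists [:: n]; rewrite // /P big_seq1.
  apply: smallest_sub; first exact: sigma_algebra_measurable.
  by move=> _ [l _ <-].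
have PI : setI_closed (range P).
  by move=> _ _ [l1 _ <-] [l2 _ <-]; exists (l1 ++ l2); rewrite // /P big_cat.
have PT : exists i, P i = setT by exists [::]; rewrite /P big_nil.
exists (fun n => if @unpickle (nat * seq nat)%type n is Some (k, l)
  then toL2 mu (indc (W k `&` P l)) else 0) => x xu.
have xkl k l : dotp x (toL2 mu (indc (W k `&` P l))) = 0.
  by have := xu (pickle (k, l)); rewrite pickleK.
have Wsub k l : (mu (W k `&` P l) < +oo)%E.
  by apply: le_lt_trans (Wfin k); rewrite le_measure ?inE//; exact: measurableI.
(* [p] stands for the real or the imaginary part; real factors such as indicators pass through
   both. *)
have part (p : R[i] -> R) : (forall (r : R) z, p (z * r%:C%C) = p z * r) ->
    (forall k, mu.-integrable setT (fun t => (p (L2_fun x t * (indc (W k) t)))%:E)) ->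
    (forall k l, (\int[mu]_t (p (L2_fun x t * (indc (W k `&` P l) t)))%:E = 0)%E) ->
    {ae mu, forall t, p (L2_fun x t) = 0}.
  move=> pM ip p0.
  have : {ae mu, forall t, forall k, p (L2_fun x t * indc (W k) t) = 0}.
    apply: ae_foralln => k; apply: ae0_pi_system (ip k) PE PI PT _ => l.
    rewrite integral_mkcond -(p0 k l); apply: eq_integral => t _.
    rewrite patchE /indc !pM !indicE in_setI.
    by case: (t \in P l); rewrite ?andbT// andbF mulr0.
  apply: filterS => t h; have [k _ Wt] : (\bigcup_n W n) t by rewrite WT.
  by have := h k; rewrite /indc pM indicE mem_set// mulr1.
have conj1 A t : ((indc A t)^*)%C = indc A t by rewrite /indc conjc_real.
have dE (A : set T) t : dotp (L2_fun x t) (indc A t) = L2_fun x t * indc A t.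
  by rewrite -[in RHS]conj1.
have re0 : {ae mu, forall t, complex.Re (L2_fun x t) = 0}.
  apply: part => [r [? ?] /=|k|k l]; first by rewrite mulr0 subr0.
    under eq_fun do rewrite -dE.
    by apply: (dotp_integrable (L2_sq x) _).1; exact: indc_sq.
  under eq_integral do rewrite -dE.
  have sq := indc_sq (measurableI _ _ (mW k) (mP l)) (Wsub k l).
  have [<- _] := L2_dot_ae (L2_sm x) sq.1 (aeW _ (fun t => erefl)) (toL2P sq).
  by rewrite xkl.
have im0 : {ae mu, forall t, complex.Im (L2_fun x t) = 0}.
  apply: part => [r [? ?] /=|k|k l]; first by rewrite mulr0 add0r.
    under eq_fun do rewrite -dE.
    by apply: (dotp_integrable (L2_sq x) _).2; exact: indc_sq.
  under eq_integral do rewrite -dE.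
  have sq := indc_sq (measurableI _ _ (mW k) (mP l)) (Wsub k l).
  have [_ <-] := L2_dot_ae (L2_sm x) sq.1 (aeW _ (fun t => erefl)) (toL2P sq).
  by rewrite xkl.
apply/eqP; rewrite -nrm_eq0 -sqrf_eq0; apply/eqP.
apply/EFin_inj; rewrite (@L2_nrm2_ae _ _ _ _ _ x (fun=> 0)).
- by under eq_integral do rewrite nrm0 expr0n; rewrite integral0.
- exact: strongly_measurable_cst.
- by move: re0 im0; apply: filterS2 => t; case: (L2_fun x t) => a b0 /= -> ->.
Qed.

End L2_separable.

Lemma L2_section_basis (R : realType) (A : topGroupType) (B : zmodClosed A)
    (S : borel_section B) (m : {measure set (borel (section_type S)) -> \bar R}) :
  @second_countable A -> section_haar_measure m ->
  exists a : nat -> L2 m R[i]^o, basis_seq a.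
Proof.
move=> /second_countable_network[b [bo bP]] mH.
have [W [mW Wfin WT]] := section_sigma_finite (ex_intro _ b bP) mH.
have [||u] := @L2_total_seq _ _ _ m W (fun n => set_val @^-1` b n) mW Wfin WT.
- by move=> n; apply: sub_sigma_algebra; exists (b n) => //; exact: bo.
- move=> U; apply: smallest_sub; first exact: smallest_sigma_algebra.
  move=> V oV; apply: network_generates oV; exact: section_network bP.
- exact: basis_seq_exists.
Qed.

(** * Decomposable operators *)

(** The form of U^* U, obtained without an adjoint; its trace is the squared Hilbert-Schmidt norm of
    [U]. *)
Lemma psd_form_adjoint (R : realType) (H K : innerProductType R) (V : set H) (U : H -> K) :
  bounded_linear_on V U -> psd_form V (fun x y => dotp (U x) (U y)).
Proof.
move=> [UL [M UM]]; split.
- by move=> a x y z Vx Vy _; rewrite UL// dotpDl dotpZl.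
- by move=> x y _ _; rewrite dotpC.
- by move=> x _; rewrite dotp_nrm sqr_ge0.
- exists (M ^+ 2) => x Vx; rewrite dotp_nrm /= -exprMn.
  by rewrite ler_pXn2r ?nnegrE ?nrm_ge0 ?UM// (le_trans (nrm_ge0 _) (UM _ Vx)).
Qed.

Lemma nrm_dotp (R : realType) (H : innerProductType R) (x y : H) :
  nrm (dotp x y : R[i]^o) <= nrm x * nrm y.
Proof.
rewrite -(ler_pXn2r (n := 2)) ?nnegrE ?mulr_ge0 ?nrm_ge0//.
by rewrite nrm_csq exprMn dotp_CS.
Qed.

Lemma Re_le_nrm (R : realType) (z : R[i]^o) : `|complex.Re z| <= nrm z.
Proof.
rewrite -(ler_pXn2r (n := 2)) ?nnegrE ?nrm_ge0// nrm_csq real_normK ?num_real//.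
by rewrite lerDl sqr_ge0.
Qed.

Lemma Im_le_nrm (R : realType) (z : R[i]^o) : `|complex.Im z| <= nrm z.
Proof.
rewrite -(ler_pXn2r (n := 2)) ?nnegrE ?nrm_ge0// nrm_csq real_normK ?num_real//.
by rewrite lerDr sqr_ge0.
Qed.

Lemma psd_form_positive (R : realType) (H : innerProductType R) (V : set H) (U : H -> H) :
  lin_closed V -> bounded_linear_on V U -> positive_on V U ->
  psd_form V (fun x y => dotp (U x) y).
Proof.
move=> lV [UL [M UM]] U0.
have Im0 x : V x -> complex.Im (dotp (U x) x) = 0.
  by move=> /U0; case: (dotp _ _) => a b; rewrite lecE /= => /andP[/eqP].
split.
- by move=> a x y z Vx Vy _; rewrite UL// dotpDl dotpZl.
- move=> x y Vx Vy.
  (* Polarisation: reality of the form at x + y and at ix + y forces hermitian symmetry. *)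
  have := Im0 _ (lV.2 1 _ _ Vx Vy); have := Im0 _ (lV.2 'i%C _ _ Vx Vy).
  rewrite !UL// !dotpDl !dotpDr !dotpZl !dotpZr.
  have := Im0 _ Vx; have := Im0 _ Vy.
  case: (dotp (U x) x) (dotp (U y) y) (dotp (U x) y) (dotp (U y) x)
    => [a1 a2] [b1 b2] [c1 c2] [d1 d2] /= -> ->; move=> h1 h2.
  by apply/eqP; rewrite eq_complex /=; apply/andP; split; apply/eqP; lra.
- by move=> x /U0; case: (dotp _ _) => a b; rewrite lecE /= => /andP[].
- exists M => x Vx; apply: le_trans (le_trans (ler_norm _) (Re_le_nrm _)) _.
  apply: le_trans (nrm_dotp _ _) _.
  by rewrite expr2 mulrA ler_wpM2r ?nrm_ge0 ?UM.
Qed.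

(** * A countable dense set of the fibre space *)

Section rational_combinations.
Context (R : realType) (H : innerProductType R) (H_complete : seq_complete H).
Context (a : nat -> H) (aP : basis_seq a).

Definition rat_comb (p : seq (rat * rat)) : H :=
  \sum_(i < size p) cratr R (nth (0, 0) p i) *: a i.

Lemma rat_comb_dense x (e : R) : 0 < e -> exists p, nrm (x - rat_comb p) < e.
Proof.
move=> e0; have e20 : 0 < e / 2 by rewrite divr_gt0.
have [N /(_ N (leqnn N)) xN] := basis_seq_expansion H_complete aP x e20.
have r0 : 0 < e / 2 / N.+1%:R by rewrite divr_gt0.
have [p pP] := choice (fun m => cratr_dense (dotp x (a m) : R[i]^o) r0).
exists (mkseq p N); apply: le_lt_trans (nrm_dist_le _ (\sum_(m < N) dotp x (a m) *: a m) _) _.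
rewrite [ltRHS]splitr ltr_leD//.
have -> : rat_comb (mkseq p N) = \sum_(m < N) cratr R (p m) *: a m.
  by rewrite /rat_comb size_mkseq; apply: eq_bigr => i _; rewrite nth_mkseq.
rewrite -sumrB; apply: (@le_trans _ _ (N%:R * (e / 2 / N.+1%:R))).
  have sumle (n : nat) (r : R) (h : nat -> H) : (forall m, nrm (h m) <= r) ->
      nrm (\sum_(m < n) h m) <= n%:R * r.
    move=> hr; elim: n => [|n IH]; first by rewrite big_ord0 nrm0 mul0r.
    by rewrite big_ord_recr /= (le_trans (nrmD _ _))// -natr1 mulrDl mul1r lerD.
  apply: (sumle N _ (fun m => dotp x (a m) *: a m - cratr R (p m) *: a m)) => m.
  rewrite -scalerBl nrmZl -[leRHS]mulr1 ler_pM ?nrm_ge0 ?(ltW (pP m))//.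
  by have [_ a1 _] := aP; have [->//|->] := a1 m; rewrite nrm0.
rewrite mulrCA ger_pMr// ler_pdivrMr// mul1r ler_nat//.
Qed.

End rational_combinations.

Section decomposable.
Context d (T : measurableType d) (R : realType) (mu : {measure set T -> \bar R}).
Context (W : nat -> set T).
Hypotheses (mW : forall n, measurable (W n)) (Wfin : forall n, (mu (W n) < +oo)%E)
  (WT : \bigcup_n W n = setT).
Context (K : innerProductType R) (K_complete : seq_complete K).
Context (a : nat -> K) (aP : basis_seq a).
Context (J : T -> set K) (J_range : measurable_range_function J).

Let lJ w : lin_closed (J w). Proof. by have [+ _] := closed_subspace_adh (J_range.1 w). Qed.
Let cJ w : adh_closed (J w). Proof. by have [_ +] := closed_subspace_adh (J_range.1 w). Qed.

Definition proj_field (A : set T) (x : K) (w : T) : K :=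
  (\1_A w : R)%:C%C *: orthproj (J w) x.

Lemma proj_field_mem A x w : J w (proj_field A x w).
Proof. by apply: lin_closedZ => //; exact: orthproj_mem. Qed.

Lemma proj_field_in (A : set T) x w : A w -> proj_field A x w = orthproj (J w) x.
Proof. by move=> Aw; rewrite /proj_field indicE mem_set// scale1r. Qed.

Lemma proj_field_out (A : set T) x w : ~ A w -> proj_field A x w = 0.
Proof. by move=> Aw; rewrite /proj_field indicE memNset// scale0r. Qed.

Lemma nrm_proj_field A x w : nrm (proj_field A x w) ^+ 2 <= \1_A w * nrm x ^+ 2.
Proof.
rewrite nrm2Z csq_real indicE; case: (w \in A); rewrite /= ?expr0n ?mul0r//.
by rewrite expr1n !mul1r ler_pXn2r ?nnegrE ?nrm_ge0// nrm_orthproj.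
Qed.

(** The weak measurability of the projections becomes strong measurability by
    [strongly_measurable_basis], the field being bounded by [nrm x]. *)
Lemma proj_field_sq A x : measurable A -> (mu A < +oo)%E ->
  sq_integrable mu (proj_field A x).
Proof.
move=> mA Afin; have sm : strongly_measurable (proj_field A x).
  apply: (@strongly_measurable_basis _ _ _ _ K_complete a aP _ (Num.truncn (nrm x)).+1).
    move=> n; have [mr mi] := J_range.2 x (a n).
    split.
      rewrite (_ : (fun _ => _) = fun w => \1_A w * complex.Re (dotp (orthproj (J w) x) (a n))).
        by apply: measurable_funM => //; exact: measurable_indic.
      by apply/funext => w; rewrite dotpZl ReM_real.
    rewrite (_ : (fun _ => _) = fun w => \1_A w * complex.Im (dotp (orthproj (J w) x) (a n))).
      by apply: measurable_funM => //; exact: measurable_indic.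
    by apply/funext => w; rewrite dotpZl; case: (dotp _ _) => u v /=; rewrite mul0r addr0.
  move=> w; apply: le_trans (ltW (truncnS_gt (nrm x))).
  rewrite -(ler_pXn2r (n := 2)) ?nnegrE ?nrm_ge0//.
  apply: le_trans (nrm_proj_field _ _ _) _.
  by rewrite ler_piMl ?sqr_ge0// indicE; case: (w \in A).
split => //; apply: (@le_lt_trans _ _ (\int[mu]_w ((nrm x ^+ 2)%:E * (\1_A w)%:E))%E).
  apply: ge0_le_integral => //.
  - by move=> w _; rewrite lee_fin sqr_ge0.
  - exact/measurable_EFinP/measurable_nrm2.
  - by apply/measurable_EFinP; apply: measurable_funM => //; exact: measurable_indic.
  - by move=> w _; rewrite -EFinM lee_fin mulrC nrm_proj_field.
rewrite ge0_integralZl_EFin ?sqr_ge0//; last first.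
  by apply/measurable_EFinP; exact: measurable_indic.
by rewrite integral_indic// setIT lte_mul_pinfty ?lee_fin ?sqr_ge0.
Qed.

Lemma proj_field_lin A c x y : measurable A -> (mu A < +oo)%E ->
  toL2 mu (proj_field A (c *: x + y)) =
  c *: toL2 mu (proj_field A x) + toL2 mu (proj_field A y).
Proof.
move=> mA Afin; apply: L2_ext.
have e1 := toL2P (proj_field_sq (c *: x + y) mA Afin).
have e2 := toL2P (proj_field_sq x mA Afin).
have e3 := toL2P (proj_field_sq y mA Afin).
have e4 := L2_linE c (toL2 mu (proj_field A x)) (toL2 mu (proj_field A y)).
have e23 : {ae mu, forall w, c *: L2_fun (toL2 mu (proj_field A x)) w +
    L2_fun (toL2 mu (proj_field A y)) w = c *: proj_field A x w + proj_field A y w}.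
  by move: e2 e3; apply: filterS2 => w -> ->.
move: e1 e4 e23; apply: filterS3 => w -> -> ->.
by rewrite /proj_field orthprojPZ// scalerDr !scalerA [_ * c]mulrC.
Qed.

(** Combining the fields amounts to combining the a_j before projecting; thus the Bessel bound 1 of
    [a] becomes mu A for the fields. *)
Lemma proj_field_sum A N (c : nat -> R[i]) : measurable A -> (mu A < +oo)%E ->
  \sum_(j < N) c j *: toL2 mu (proj_field A (a j)) =
  toL2 mu (proj_field A (\sum_(j < N) c j *: a j)).
Proof.
move=> mA Afin; have lin := fun c x y => @proj_field_lin A c x y mA Afin.
elim: N => [|N IH]; last first.
  rewrite !big_ord_recr /= IH addrC -lin.
  by congr (toL2 _ (proj_field _ _)); exact: addrC.
rewrite !big_ord0; have := lin 1 0 0; rewrite scaler0 addr0 scale1r => /eqP.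
by rewrite -subr_eq0 opprD addrA subrr sub0r oppr_eq0 => /eqP ->.
Qed.

Lemma proj_field_nrm A x : measurable A -> (mu A < +oo)%E ->
  nrm (toL2 mu (proj_field A x)) ^+ 2 <= fine (mu A) * nrm x ^+ 2.
Proof.
move=> mA Afin; have sq := proj_field_sq x mA Afin.
rewrite -lee_fin (L2_nrm2_ae sq.1 (toL2P sq)).
apply: (@le_trans _ _ (\int[mu]_w ((nrm x ^+ 2)%:E * (\1_A w)%:E))%E).
  apply: ge0_le_integral => //.
  - by move=> w _; rewrite lee_fin sqr_ge0.
  - by apply/measurable_EFinP/measurable_nrm2; exact: sq.1.
  - by apply/measurable_EFinP; apply: measurable_funM => //; exact: measurable_indic.
  - by move=> w _; rewrite -EFinM lee_fin mulrC nrm_proj_field.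
rewrite ge0_integralZl_EFin ?sqr_ge0//; last first.
  by apply/measurable_EFinP; exact: measurable_indic.
rewrite integral_indic// setIT [leRHS]EFinM fineK 1?[leRHS]muleC//.
by rewrite ge0_fin_numE.
Qed.

Context (H : innerProductType R) (H_complete : seq_complete H).
Context (Z : {linear H -> L2 mu K}) (Z_isometry : forall f, `|Z f| = `|f|)
  (Z_surjective : forall F, exists f, Z f = F).
Context (V : set H) (V_closed : closed_subspace V).
Hypothesis V_J : V = [set f | {ae mu, forall w, J w (L2_fun (Z f) w)}].

Let lV : lin_closed V. Proof. by have [+ _] := closed_subspace_adh V_closed. Qed.
Let cV : adh_closed V. Proof. by have [_ +] := closed_subspace_adh V_closed. Qed.

Lemma isometry_nrm f : nrm (Z f) = nrm f. Proof. by rewrite /nrm Z_isometry. Qed.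

Lemma isometry_dotp f g : dotp (Z f) (Z g) = dotp f g.
Proof.
have re x y : complex.Re (dotp (Z x) (Z y)) = complex.Re (dotp x y).
  by rewrite !Re_dotp -linearD !isometry_nrm.
have ZZ (c : R[i]) x : c *: Z x = Z (c *: x) by rewrite linearZ.
apply/eqP; rewrite eq_complex re eqxx andTb; apply/eqP.
by rewrite !Im_dotp ZZ re.
Qed.

Lemma proj_field_lift A x : measurable A -> (mu A < +oo)%E ->
  exists2 f, V f & Z f = toL2 mu (proj_field A x).
Proof.
move=> mA Afin; have [f Zf] := Z_surjective (toL2 mu (proj_field A x)).
exists f => //; rewrite V_J /= Zf.
have := toL2P (proj_field_sq x mA Afin); apply: filterS => w ->.
exact: proj_field_mem.
Qed.

(** Shared by both kinds of operators. The function h is a measurable version of the fibre form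
    along [f], nonnegative everywhere; it is asked for because [Q w] is controlled only for almost
    every w. *)
Lemma form_trace_ae (Q : T -> K -> K -> R[i]) (q : H -> H -> R[i]) (E : set H) :
  psd_form V q -> orthonormal_basis V E ->
  (\esum_(e in E) (complex.Re (q e e))%:E < +oo)%E ->
  {ae mu, forall w, psd_form (J w) (Q w)} ->
  (forall f, V f -> exists h : T -> R, [/\ measurable_fun setT h, forall w, 0 <= h w,
    {ae mu, forall w, h w = complex.Re (Q w (L2_fun (Z f) w) (L2_fun (Z f) w))} &
    (\int[mu]_w (h w)%:E = (complex.Re (q f f))%:E)%E]) ->
  {ae mu, forall w, exists2 F, orthonormal_basis (J w) F &
    (\esum_(e in F) (complex.Re (Q w e e))%:E < +oo)%E}.
Proof.
move=> qP EP Eoo QP qQ.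
have EV : E `<=` V by case: EP.
set t := (\esum_(e in E) (complex.Re (q e e))%:E)%E in Eoo.
have t0 : (0 <= t)%E.
  by apply: esum_ge0 => e /EV Ve; rewrite lee_fin (form_ge0 qP).
have tf : t \is a fin_num by rewrite ge0_fin_numE.
have main k : {ae mu, forall w, W k w -> (\sum_(n <oo)
    (complex.Re (Q w (orthproj (J w) (a n)) (orthproj (J w) (a n))))%:E < +oo)%E}.
  have [f fP] := choice (fun n => let: ex_intro2 f Vf Zf :=
    proj_field_lift (a n) (mW k) (Wfin k) in ex_intro (fun f => V f /\ Z f = _) f (conj Vf Zf)).
  have [h hP] := choice (fun n => qQ (f n) (fP n).1).
  have mh n : measurable_fun setT (EFin \o h n) by apply/measurable_EFinP; have [] := hP n.
  have h0 n w : (0 <= (h n w)%:E)%E by rewrite lee_fin; have [_ h0 _ _] := hP n.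
  have hI n : (\int[mu]_w (h n w)%:E = (complex.Re (q (f n) (f n)))%:E)%E by have [] := hP n.
  have fB N : bessel_family f N (fine (mu (W k))).
    move=> c; rewrite -isometry_nrm linear_sum.
    have -> : \sum_(j < N) Z (c j *: f j) = toL2 mu (proj_field (W k) (\sum_(j < N) c j *: a j)).
      by rewrite -proj_field_sum//; apply: eq_bigr => j _; rewrite linearZ (fP j).2.
    apply: le_trans (proj_field_nrm _ (mW k) (Wfin k)) _.
    rewrite ler_wpM2l ?fine_ge0//.
    by have := @basis_seq_comb_bessel _ _ _ aP N c; rewrite mul1r.
  have intS : (\int[mu]_w (\sum_(n <oo) (h n w)%:E) < +oo)%E.
    rewrite integral_nneseries//.
    apply: (@le_lt_trans _ _ (fine (mu (W k)) * fine t)%:E); last exact: ltry.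
    apply: lime_le.
      by apply: is_cvg_nneseries => n _ _; exact: integral_ge0.
    apply: nearW => N; rewrite big_mkord.
    under eq_bigr do rewrite hI.
    rewrite sumEFin lee_fin.
    (* The bound mu (W k) times [t] does not depend on the number of terms, hence passes to the
       series. *)
    apply: (form_trace_bessel H_complete lV cV EP qP); rewrite ?fineK ?fine_ge0//.
    by move=> j; exact: (fP j).1.
  have S0 w : (0 <= \sum_(n <oo) (h n w)%:E)%E by apply: nneseries_ge0 => n _ _; exact: h0.
  have iS : mu.-integrable setT (fun w => (\sum_(n <oo) (h n w)%:E)%E).
    apply/integrableP; split.
      apply: (ge0_emeasurable_sum (h := fun n w => (h n w)%:E)) => n *.
        exact: h0.
      exact: mh.
    apply: le_lt_trans intS; rewrite le_eqVlt; apply/orP; left; apply/eqP.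
    by apply: eq_integral => w _; rewrite gee0_abs// S0.
  have fin := integrable_ae measurableT iS.
  have hQ : {ae mu, forall w, forall n,
      h n w = complex.Re (Q w (L2_fun (Z (f n)) w) (L2_fun (Z (f n)) w))}.
    by apply: ae_foralln => n; have [] := hP n.
  have Zf : {ae mu, forall w, forall n, L2_fun (Z (f n)) w = proj_field (W k) (a n) w}.
    by apply: ae_foralln => n; rewrite (fP n).2; apply: toL2P; exact: proj_field_sq.
  move: fin hQ Zf; apply: filterS3 => w /(_ Logic.I) fin hQ Zf Ww.
  move: fin; rewrite ge0_fin_numE ?S0//.
  by under eq_eseriesr do rewrite hQ Zf proj_field_in//.
have := ae_foralln main; move: QP; apply: filterS2 => w Qw Sw.
have [k _ Wk] : (\bigcup_n W n) w by rewrite WT.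
exact: (form_trace_restrict K_complete aP (lJ w) (@cJ w) Qw (Sw k Wk)).
Qed.

(** * Fibres of Hilbert-Schmidt operators and of positive operators *)

Context (U : H -> H) (U_V : forall f, V f -> V (U f)) (U_lin : bounded_linear_on V U).
Context (S : T -> K -> K) (S_lin : {ae mu, forall w, bounded_linear_on (J w) (S w)}).
Hypothesis U_S : forall f, V f ->
  {ae mu, forall w, L2_fun (Z (U f)) w = S w (L2_fun (Z f) w)}.

(** The measurable version of the fibre form is the squared norm of the representative of [Z (U f)],
    whose integral is the squared norm of [U f]. *)
Lemma hilbert_schmidt_ae : hilbert_schmidt_on V U ->
  {ae mu, forall w, hilbert_schmidt_on (J w) (S w)}.
Proof.
move=> [E EP Eoo].
have := @form_trace_ae (fun w x y => dotp (S w x) (S w y)) (fun x y => dotp (U x) (U y)) E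
  (psd_form_adjoint U_lin) EP.
have eqd (L L' : innerProductType R) (X : set L) (B : L -> L') :
    (\esum_(e in X) (complex.Re (dotp (B e) (B e)))%:E =
     \esum_(e in X) (nrm (B e) ^+ 2)%:E)%E.
  by apply: eq_esum => e _; rewrite dotp_nrm.
rewrite eqd => /(_ Eoo) h.
have {}h : {ae mu, forall w, exists2 F, orthonormal_basis (J w) F &
    (\esum_(e in F) (complex.Re (dotp (S w e) (S w e)))%:E < +oo)%E}.
  apply: h => [|f Vf]; first by move: S_lin; apply: filterS => w; exact: psd_form_adjoint.
  exists (fun w => nrm (L2_fun (Z (U f)) w) ^+ 2); split.
  - exact/measurable_nrm2/L2_sm.
  - by move=> w; exact: sqr_ge0.
  - by move: (U_S Vf); apply: filterS => w ->; rewrite dotp_nrm.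
  - by rewrite -L2_nrm2 isometry_nrm dotp_nrm.
by move: h; apply: filterS => w [F FP]; rewrite eqd => Foo; exists F.
Qed.

(** Restricting the field of [x] to a measurable B keeps it in the image of [V], and the positivity
    of [U] there says that the fibre form has a nonnegative real integral over every B; hence it is
    nonnegative a.e. *)
Lemma positive_lift_ae k x : positive_on V U ->
  {ae mu, forall w, W k w -> 0 <= dotp (S w (orthproj (J w) x)) (orthproj (J w) x)}.
Proof.
move=> U0; have [f Vf Zf] := proj_field_lift x (mW k) (Wfin k).
pose g w := dotp (L2_fun (Z (U f)) w) (L2_fun (Z f) w).
have [iRe iIm] := L2_dot_integrable (Z (U f)) (Z f).
have Zf' : {ae mu, forall w, L2_fun (Z f) w = proj_field (W k) x w}.
  by rewrite Zf; apply: toL2P; exact: proj_field_sq.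
have gB B : measurable B -> exists2 z : R[i], 0 <= z &
    (\int[mu]_(w in B) (complex.Re (g w))%:E = (complex.Re z)%:E)%E /\
    (\int[mu]_(w in B) (complex.Im (g w))%:E = (complex.Im z)%:E)%E.
  move=> mB; have mWB : measurable (W k `&` B) by exact: measurableI.
  have WBfin : (mu (W k `&` B) < +oo)%E.
    by apply: le_lt_trans (Wfin k); rewrite le_measure ?inE//; exact: mW.
  have [fB VfB ZfB] := proj_field_lift x mWB WBfin.
  exists (dotp (U fB) fB); first exact: U0.
  have ZfB' : {ae mu, forall w, L2_fun (Z fB) w = proj_field (W k `&` B) x w}.
    by rewrite ZfB; apply: toL2P; exact: proj_field_sq.
  have eg : {ae mu, forall w, dotp (L2_fun (Z (U fB)) w) (L2_fun (Z fB) w) =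
      if w \in B then g w else 0}.
    have e1 : {ae mu, forall w, L2_fun (Z (U fB)) w = S w (proj_field (W k `&` B) x w)}.
      by move: (U_S VfB) ZfB'; apply: filterS2 => w -> ->.
    have e2 : {ae mu, forall w, g w = dotp (S w (proj_field (W k) x w)) (proj_field (W k) x w)}.
      by move: (U_S Vf) Zf'; apply: filterS2 => w; rewrite /g => -> ->.
    move: e1 ZfB' e2; apply: filterS3 => w -> -> ->; case: ifPn => [/set_mem Bw|/negP wB].
      by rewrite /proj_field !indicE in_setI (mem_set Bw) andbT.
    (* Off B the second argument vanishes, so the value of [S w] at 0 does not matter. *)
    rewrite [X in dotp _ X](_ : _ = 0) ?dotp0r// proj_field_out// => -[_ Bw].
    by apply: wB; exact: mem_set.
  rewrite -isometry_dotp L2_Re_dot L2_Im_dot.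
  have [mRe mIm] := complex_measurable_dotp (L2_sm (Z (U fB))) (L2_sm (Z fB)).
  have [mRe' mIm'] := complex_measurable_dotp (L2_sm (Z (U f))) (L2_sm (Z f)).
  split; rewrite integral_mkcond; apply: ae_eq_integral => //.
  - apply/measurable_restrict => //; rewrite setTI.
    by apply/measurable_EFinP; exact: measurable_funS mRe'.
  - exact/measurable_EFinP.
  - by move: eg; apply: filterS => w -> _; rewrite patchE; case: ifP.
  - apply/measurable_restrict => //; rewrite setTI.
    by apply/measurable_EFinP; exact: measurable_funS mIm'.
  - exact/measurable_EFinP.
  - by move: eg; apply: filterS => w -> _; rewrite patchE; case: ifP.
have im0 : {ae mu, forall w, complex.Im (g w) = 0}.
  have : ae_eq mu setT (fun w => (complex.Im (g w))%:E) (cst 0%E).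
    apply: integral_ae_eq => // B _ mB; rewrite integral0.
    have [z z0 [_ ->]] := gB B mB; congr EFin.
    by move: z0; case: (z) => u v; rewrite lecE /= => /andP[/eqP].
  by apply: filterS => w /(_ Logic.I) [].
(* Over a measurable part of [N] the integral is nonpositive by sign and nonnegative by [gB], so [g]
   would have zero real part a.e. on [N]. *)
pose N := [set w | complex.Re (g w) < 0].
have mN : measurable N.
  have [mRe' _] := complex_measurable_dotp (L2_sm (Z (U f))) (L2_sm (Z f)).
  have -> : N = setT `&` (fun w => complex.Re (g w)) @^-1` `]-oo, 0[.
    by rewrite setTI; apply/seteqP; split => w /=; rewrite in_itv.
  by apply: mRe' => //; exact: measurable_itv.
have re0 : {ae mu, forall w, 0 <= complex.Re (g w)}.
  have : ae_eq mu N (fun w => (complex.Re (g w))%:E) (cst 0%E).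
    apply: integral_ae_eq => //; first by apply: integrableS iRe.
    move=> B BN mB; rewrite integral0; apply/eqP; rewrite eq_le; apply/andP; split.
      rewrite -[leRHS](integral0 mu B); apply: le_integral => //.
      - by apply: integrableS iRe.
      - exact: integrable0.
      - by move=> w /set_mem /BN /ltW; rewrite lee_fin.
    have [z z0 [-> _]] := gB B mB; rewrite lee_fin.
    by move: z0; case: (z) => u v; rewrite lecE /= => /andP[].
  apply: filterS => w h; rewrite leNgt; apply/negP => wN.
  by have [] := h wN => /eqP; rewrite lt_eqF.
have e2 : {ae mu, forall w, g w = dotp (S w (proj_field (W k) x w)) (proj_field (W k) x w)}.
  by move: (U_S Vf) Zf'; apply: filterS2 => w; rewrite /g => -> ->.
move: im0 re0 e2; apply: filterS3 => w h1 h2 h3 Ww.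
move: h3; rewrite proj_field_in// => <-; move: h1 h2; case: (g w) => u v /= -> u0.
by rewrite lecE /= eqxx.
Qed.

(** The null set of [positive_lift_ae] depends on the vector, so it is applied to the countably many
    rational combinations; their projections are dense in [J w], and the boundedness of [S w]
    extends positivity to all of [J w]. *)
Lemma positive_ae : positive_on V U -> {ae mu, forall w, positive_on (J w) (S w)}.
Proof.
move=> U0.
have h : {ae mu, forall w, forall k n, W k w ->
    let x := if @unpickle (seq (rat * rat))%type n is Some p then rat_comb a p else 0 in
    0 <= dotp (S w (orthproj (J w) x)) (orthproj (J w) x)}.
  by apply: ae_foralln => k; apply: ae_foralln => n; exact: positive_lift_ae.
move: S_lin h; apply: filterS2 => w [SL [M SM]] h x Jx.
have [k _ Wk] : (\bigcup_n W n) w by rewrite WT.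
have {}h p : 0 <= dotp (S w (orthproj (J w) (rat_comb a p))) (orthproj (J w) (rat_comb a p)).
  by have := h k (pickle p) Wk; rewrite pickleK.
set z := dotp _ _.
(* The nonnegative reals are closed in [R[i]]. *)
suff zP (e : R) : 0 < e -> exists2 z' : R[i]^o, 0 <= z' & nrm ((z : R[i]^o) - z') < e.
  have zi : complex.Im z = 0.
    apply/eqP; rewrite -normr_le0; apply/ler_addgt0Pr => e /zP[z' z'0 zz']; rewrite add0r.
    have := Im_le_nrm ((z : R[i]^o) - z'); move: z'0 zz'; case: (z) (z') => [z1 z2] [u v].
    by rewrite lecE /= => /andP[/eqP -> _]; rewrite subr0 => *; lra.
  have zr : 0 <= complex.Re z.
    apply/ler_addgt0Pr => e /zP[z' z'0 zz'].
    have := Re_le_nrm ((z : R[i]^o) - z'); move: z'0 zz'; case: (z) (z') => [z1 z2] [u v].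
    by rewrite lecE /= ler_norml => /andP[_ u0] h1 /andP[h2 _]; lra.
  by move: zi zr; case: (z) => u v /= -> u0; rewrite lecE /= eqxx.
(* Replacing x by y changes the form by at most |x - y| |M| (|x| + |y|), and |y| <= |x| + 1 as soon
   as |x - y| <= 1, which the minimum in [del] ensures. The final + 1 keeps [L] positive when M =
   0. *)
move=> e0; pose L := `|M| * (nrm x *+ 2 + 1) + 1.
have L0 : 0 < L.
  by rewrite ltr_wpDl// mulr_ge0// addr_ge0// mulrn_wge0// nrm_ge0.
pose del := Num.min 1 (e / L).
have del0 : 0 < del by rewrite lt_min ltr01 divr_gt0.
have [p xp] := rat_comb_dense K_complete aP x del0.
set y := orthproj (J w) (rat_comb a p).
have Jy : J w y by exact: orthproj_mem.
have xy : nrm (x - y) < del.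
  have <- : orthproj (J w) (x - rat_comb a p) = x - y.
    rewrite addrC -scaleN1r orthprojPZ//.
    by rewrite (orthproj_id K_complete (lJ w) (@cJ w) Jx) scaleN1r addrC.
  by apply: le_lt_trans xp; exact: nrm_orthproj.
exists (dotp (S w y) y); first exact: h.
have SB : S w x - S w y = S w (x - y).
  by rewrite [in RHS]addrC -[in RHS]scaleN1r SL// scaleN1r addrC.
have -> : (z : R[i]^o) - dotp (S w y) y = dotp (S w (x - y)) x + dotp (S w y) (x - y).
  by rewrite -SB dotpBl dotpBr addrA subrK.
have SM' v : J w v -> nrm (S w v) <= `|M| * nrm v.
  by move=> Jv; apply: le_trans (SM v Jv) _; rewrite ler_wpM2r ?nrm_ge0 ?ler_norm.
apply: le_lt_trans (nrmD (_ : R[i]^o) _) _.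
have h1 := nrm_dotp (S w (x - y)) x; have h2 := nrm_dotp (S w y) (x - y).
have Jxy : J w (x - y) by exact: lin_closedB.
have h3 : nrm (S w (x - y)) * nrm x <= `|M| * nrm (x - y) * nrm x.
  by rewrite ler_wpM2r ?nrm_ge0 ?SM'.
have h4 : nrm (S w y) * nrm (x - y) <= `|M| * nrm y * nrm (x - y).
  by rewrite ler_wpM2r ?nrm_ge0 ?SM'.
have h5 : nrm y <= nrm x + 1.
  have := nrm_dist_le y x 0; rewrite !subr0 nrmBC => h5; apply: le_trans h5 _.
  rewrite addrC lerD2l; apply: le_trans (ltW xy) _.
  by rewrite /del ge_min lexx.
have h6 : nrm (x - y) * L < e.
  by rewrite -ltr_pdivlMr// (lt_le_trans xy)// /del ge_min lexx orbT.
apply: le_lt_trans h6; apply: (le_trans (lerD (le_trans h1 h3) (le_trans h2 h4))).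
have h7 : `|M| * nrm y * nrm (x - y) <= `|M| * (nrm x + 1) * nrm (x - y).
  by rewrite ler_wpM2r ?nrm_ge0// ler_wpM2l.
apply: le_trans (lerD (lexx _) h7) _.
have := nrm_ge0 (x - y); rewrite /L; move: (nrm (x - y)) (nrm x) `|M| => r s m r0.
by rewrite (_ : _ + _ = r * (m * (s *+ 2 + 1))); [rewrite ler_wpM2l ?lerDl|ring].
Qed.

(** Fibrewise positivity has to come before the trace, since it makes <S w x, y> a positive
    semidefinite form for almost every w. *)
Lemma finite_trace_ae : positive_on V U -> finite_trace_on V U ->
  {ae mu, forall w, finite_trace_on (J w) (S w)}.
Proof.
move=> U0 [E EP Eoo].
have Q0 : {ae mu, forall w, psd_form (J w) (fun x y => dotp (S w x) y)}.
  by move: S_lin (positive_ae U0); apply: filterS2 => w; exact: psd_form_positive.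
apply: (form_trace_ae (psd_form_positive lV U_lin U0) EP Eoo Q0) => f Vf.
have [mRe _] := complex_measurable_dotp (L2_sm (Z (U f))) (L2_sm (Z f)).
have VJf : {ae mu, forall w, J w (L2_fun (Z f) w)} by move: Vf; rewrite {1}V_J.
have hQ : {ae mu, forall w, `|complex.Re (dotp (L2_fun (Z (U f)) w) (L2_fun (Z f) w))| =
    complex.Re (dotp (L2_fun (Z (U f)) w) (L2_fun (Z f) w))}.
  move: (U_S Vf) Q0 VJf; apply: filterS3 => w -> Qw Jw.
  by rewrite ger0_norm// (form_ge0 Qw).
(* The absolute value makes the function nonnegative at every point; it changes it on a null set
   only. *)
exists (fun w => `|complex.Re (dotp (L2_fun (Z (U f)) w) (L2_fun (Z f) w))|); split.
- exact: measurableT_comp.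
- by move=> w; exact: normr_ge0.
- by move: hQ (U_S Vf); apply: filterS2 => w -> ->.
- rewrite -isometry_dotp L2_Re_dot; apply: ae_eq_integral => //.
  + by apply/measurable_EFinP; exact: measurableT_comp.
  + exact/measurable_EFinP.
  + by move: hQ; apply: filterS => w -> _.
Qed.

End decomposable.

Theorem proposition3p3 (R : realType)
    (G : topologicalZmodType)
    (G_hausdorff : hausdorff_space G)
    (G_locally_compact : locally_compact [set: G])
    (G_second_countable : @second_countable G)
    (Gamma : zmodClosed G)
    (Gamma_closed : closed [set g : G | g \in Gamma])
    (Omega : borel_section (annihilator R Gamma))
    (C : borel_section Gamma)
    (mG : {measure set (gborel G) -> \bar R})
    (mO : {measure set (borel (section_type Omega)) -> \bar R})
    (mC : {measure set (borel (section_type C)) -> \bar R})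
    (mG_haar : haar_measure mG)
    (mO_haar : section_haar_measure mO)
    (mC_haar : section_haar_measure mC)
    (Z : {linear L2 mG R[i]^o -> L2 mO (L2 mC R[i]^o)})
    (Z_isometry : forall f, `|Z f| = `|f|)
    (Z_surjective : forall F, exists f, Z f = F)
    (Z_translate : forall g, g \in Gamma ->
      forall f, Z (translate g f) = mul_character g (Z f))
    (V : set (L2 mG R[i]^o))
    (V_invariant : translation_invariant Gamma V)
    (J : borel (section_type Omega) -> set (L2 mC R[i]^o))
    (J_range : measurable_range_function J)
    (V_J : V = [set f | {ae mO, forall w, J w (L2_fun (Z f) w)}])
    (U : L2 mG R[i]^o -> L2 mG R[i]^o)
    (U_V : forall f, V f -> V (U f))
    (U_preserving : translation_preserving Gamma V U)
    (U_compact : compact_on V U)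
    (S : borel (section_type Omega) -> L2 mC R[i]^o -> L2 mC R[i]^o)
    (S_range : measurable_range_operator mO J S)
    (U_S : forall f, V f -> {ae mO, forall w, L2_fun (Z (U f)) w = S w (L2_fun (Z f) w)}) :
  (hilbert_schmidt_on V U ->
    {ae mO, forall w, hilbert_schmidt_on (J w) (S w)}) /\
  (positive_on V U -> finite_trace_on V U ->
    {ae mO, forall w, positive_on (J w) (S w) /\
                      finite_trace_on (J w) (S w)}).
Proof.
have V_closed := V_invariant.1.
have U_lin := U_preserving.1.
(* Second countability enters twice: through the section [C] for a basis of the fibre space, and
   through the dual for the sigma-finiteness of [Omega]. *)
have [a aP] := L2_section_basis G_second_countable mC_haar.
have [W [mW Wfin WT]] := section_sigma_finite (dual_network R G_second_countable) mO_haar.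
have Kc := @L2_complete _ _ R mC.
have Hc := @L2_complete _ _ R mG.
split.
  exact: (hilbert_schmidt_ae mW Wfin WT Kc aP J_range Hc Z_isometry Z_surjective
    V_closed V_J U_lin S_range.1 U_S).
move=> U_pos U_trace.
have pos := positive_ae mW Wfin WT Kc aP J_range Z_isometry Z_surjective V_J
  S_range.1 U_S U_pos.
have tr := finite_trace_ae mW Wfin WT Kc aP J_range Hc Z_isometry Z_surjective
  V_closed V_J U_lin S_range.1 U_S U_pos U_trace.
by move: pos tr; apply: filterS2.
Qed.
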